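(* Let $(W,\Sigma)$ be a Coxeter system, $\pi\in W$, $Q$ a word in $W$ of size $n$ that contains $\pi$, $\Delta$ the subword complex $\Delta(Q,\pi)$, and $G(I_{\Delta^\vee})=\{\mathbf x_{P_1},\ldots,\mathbf x_{P_r}\}$ with $\mathbf x_{P_1}>_{lex}\cdots>_{lex}\mathbf x_{P_r}$. Assume $r\le n-\ell(\pi)+1$ and $d_r=r-1$, where $d_r=|\mathrm{set}(\mathbf x_{P_r})|$. Then $\Delta$ is a simplicial sphere if and only if $r=n-\ell(\pi)+1$.
   Context: $\Sigma$ is the set of simple reflections of the Coxeter group $W$ and $\ell$ the length function. A word $Q=(\sigma_1,\ldots,\sigma_n)$ of size $n$ is an ordered sequence of elements of $\Sigma$; a subword $P=(\sigma_{i_1},\ldots,\sigma_{i_m})$, $i_1<\cdots<i_m$, is an ordered subsequence (identified with its set of positions). $P$ represents $\pi$ if the ordered product of the simple reflections in $P$ is a reduced expression for $\pi$; $P$ contains $\pi$ if some subsequence of $P$ represents $\pi$. The subword complex $\Delta(Q,\pi)$ is the set of subwords $Q\setminus P$ such that $P$ contains $\pi$; it is a pure simplicial complex whose facets are the $Q\setminus P$ with $P$ representing $\pi$. For $P=(\sigma_{i_1},\ldots,\sigma_{i_m})$ put $\mathbf x_P=x_{i_1}\cdots x_{i_m}\in k[x_1,\ldots,x_n]$, $k$ a field. The Stanley--Reisner ideal of the Alexander dual of $\Delta$ is $I_{\Delta^\vee}=(\mathbf x_P: P\subseteq Q,\ P\text{ represents }\pi)$, and $G(I_{\Delta^\vee})$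 is its minimal monomial generating set. The lexicographic order is taken with $x_1>\cdots>x_n$. With this ordering, $\mathrm{set}(\mathbf x_{P_i})=\{j\in\{1,\ldots,n\}: x_j\in(\mathbf x_{P_1},\ldots,\mathbf x_{P_{i-1}}):\mathbf x_{P_i}\}$. A simplicial sphere is a simplicial complex whose geometric realization is homeomorphic to a sphere (the complex $\{\emptyset\}$ being the sphere of dimension $-1$). *)

(* Defs.v *)
From HB Require Import structures.
From mathcomp Require Import all_boot all_order all_algebra.
From mathcomp Require Import boolp classical_sets.
From mathcomp Require mpoly.

Set Implicit Arguments.
Unset Strict Implicit.
Unset Printing Implicit Defensive.

Import Order.TTheory GRing.Theory Num.Theory.

Local Open Scope classical_set_scope.
Local Open Scope ring_scope.

Definition ideal_gen (A : comNzRingType) (S : set A) : set A :=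
  [set p | exists cs : seq (A * A),
     (forall c, c \in cs -> S c.2) /\ p = \sum_(c <- cs) c.1 * c.2].

Definition colon (A : comNzRingType) (I : set A) (u : A) : set A :=
  [set p | I (p * u)].

(* The import of the multivariate polynomial notations is confined to this
   module, since they are incompatible with those of MathComp-Analysis. *)
Module Monomials.
Import mpoly.

Definition mon_ideal (k : fieldType) (n : nat) (us : seq 'X_{1..n}) :
  set {mpoly k[n]} := ideal_gen [set p | exists2 u, u \in us & p = 'X_[u]].
Arguments mon_ideal k {n} us.

(* The exponent vector of x_P. *)
Definition xmon (n : nat) (P : {set 'I_n}) : 'X_{1..n} :=
  [multinom (i \in P : nat) | i < n].

Definition stanley_reisner (k : fieldType) (n : nat) (K : {set {set 'I_n}}) :
  set {mpoly k[n]} :=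
  ideal_gen [set p | exists2 F : {set 'I_n}, F \notin K & p = 'X_[xmon F]].
Arguments stanley_reisner k {n} K.

Definition minimal_generators (k : fieldType) (n : nat)
  (I : set {mpoly k[n]}) (us : seq 'X_{1..n}) : Prop :=
  mon_ideal k us = I /\
  forall vs : seq 'X_{1..n},
    {subset vs <= us} -> mon_ideal k vs = I -> {subset us <= vs}.

(* Pure lexicographic order, the variable of index 0 being the largest. *)
Definition lex_gt (n : nat) : rel 'X_{1..n} := fun u v =>
  [exists i : 'I_n, [forall j : 'I_n, (j < i)%N ==> (u j == v j)]
                    && (v i < u i)%N].

(* Positions in [us] are counted from 0. *)
Definition lin_set (k : fieldType) (n : nat) (us : seq 'X_{1..n}) (i : nat) :
  {set 'I_n} :=
  [set j : 'I_n |
    `[< colon (mon_ideal k (take i us)) 'X_[nth 0%MM us i] ('X_j) >]]%SET.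
Arguments lin_set k {n} us i.

End Monomials.
Export Monomials.

From mathcomp Require Import all_classical all_reals all_analysis.
Import numFieldNormedType.Exports.

(* [W] is presented by the generators [Sig] subject to the relations
   [(s t)^(m s t) = 1].  The value [m s t = 0] encodes an infinite label: the
   corresponding relation is then vacuous.  Since the relations make every
   generator an involution, generation as a monoid is generation as a group.
   The last clause is the universal property of the presentation. *)
Definition coxeter_system (W : groupType) (Sig : set W) : Prop :=
  exists m : W -> W -> nat,
    [/\ forall s, Sig s -> m s s = 1%N,
        forall s t, Sig s -> Sig t -> s <> t -> m s t = m t s /\ m s t <> 1%N,
        forall s t, Sig s -> Sig t -> ((s * t) ^+ m s t = 1)%g,
        forall w : W, exists2 ws : seq W,
          (forall s, s \in ws -> Sig s) & w = (\prod_(s <- ws) s)%g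
      & forall (G : groupType) (f : W -> G),
          (forall s t, Sig s -> Sig t -> ((f s * f t) ^+ m s t = 1)%g) ->
          exists phi : W -> G,
            {morph phi : x y / (x * y)%g >-> (x * y)%g} /\
            (forall s, Sig s -> phi s = f s)].

Definition expressible (W : groupType) (Sig : set W) (w : W) (l : nat) : Prop :=
  exists ws : seq W,
    [/\ forall s, s \in ws -> Sig s, w = (\prod_(s <- ws) s)%g & size ws = l].

Definition coxlen (W : groupType) (Sig : set W) (w : W) : nat :=
  xget 0%N [set l | expressible Sig w l /\
                    forall l', expressible Sig w l' -> (l <= l')%N].

Definition is_word (W : groupType) (Sig : set W) (n : nat) (Q : n.-tuple W) :
  Prop := forall i, Sig (tnth Q i).

(* A subword of [Q] is given by its set of positions; [enum] lists them in
   increasing order. *)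
Definition letters (W : groupType) (n : nat) (Q : n.-tuple W)
  (P : {set 'I_n}) : seq W := [seq tnth Q i | i <- enum P].

Definition represents (W : groupType) (Sig : set W) (n : nat) (Q : n.-tuple W)
  (P : {set 'I_n}) (pi : W) : bool :=
  ((\prod_(s <- letters Q P) s)%g == pi) &&
  (size (letters Q P) == coxlen Sig pi).

Definition contains (W : groupType) (Sig : set W) (n : nat) (Q : n.-tuple W)
  (P : {set 'I_n}) (pi : W) : bool :=
  [exists P' : {set 'I_n}, (P' \subset P) && represents Sig Q P' pi].

Definition subword_complex (W : groupType) (Sig : set W) (n : nat)
  (Q : n.-tuple W) (pi : W) : {set {set 'I_n}} :=
  [set ~: P | P : {set 'I_n} & contains Sig Q P pi]%SET.

Definition simplicial_complex (V : finType) (K : {set {set V}}) : Prop :=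
  finset.set0 \in K /\
  forall F F' : {set V}, F \in K -> F' \subset F -> F' \in K.

Definition alexander_dual (V : finType) (K : {set {set V}}) : {set {set V}} :=
  [set ~: F | F : {set V} & F \notin K]%SET.

(* Barycentric coordinates in the standard simplex of R^n. *)
Definition realization (R : realType) (n : nat) (K : {set {set 'I_n}}) :
  set 'rV[R]_n :=
  [set x | [/\ forall i, 0 <= x 0 i, \sum_i x 0 i = 1
             & [set i | x 0 i != 0]%SET \in K]].

(* The sphere of dimension m - 1 in R^m, empty when m = 0. *)
Definition unit_sphere (R : realType) (m : nat) : set 'rV[R]_m :=
  [set x | \sum_i x 0 i ^+ 2 = 1].

Definition homeomorphic (T U : topologicalType) (A : set T) (B : set U) : Prop :=
  exists (f : T -> U) (g : U -> T),
    [/\ forall x, A x -> B (f x) /\ g (f x) = x,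
        forall y, B y -> A (g y) /\ f (g y) = y,
        {within A, continuous f} & {within B, continuous g}].

Definition simplicial_sphere (R : realType) (n : nat) (K : {set {set 'I_n}}) :
  Prop :=
  simplicial_complex K /\
  exists m : nat, homeomorphic (@realization R n K) (@unit_sphere R m).

(* Main.v *)
(* Since the P_i all have the same size, the condition d_r = r - 1 says
   that every other P_i is obtained from P_r by exchanging one position, with
   pairwise distinct new positions j_i outside P_r; the lexicographic order forces
   j_i to lie before the position p_i that is given up.

   If r < n - l(pi) + 1, some position outside P_r is not one of the j_i.  It is a
   vertex of every facet of Delta, so |Delta| is star-shaped, and contracting it to
   that vertex would make a sphere a retract of a cube.  This is impossible by the
   Poincare-Miranda theorem, itself a consequence of a discrete Stokes formula for
   F_2-valued cubical cochains.

   If r = n - l(pi) + 1, every position outside P_r is some j_i, and the exchange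
   condition shows that all the p_i coincide.  Hence Delta is the boundary of the
   simplex on the complement of P_r together with that common position.  The
   exchange condition is obtained by applying the universal property of the Coxeter
   presentation to a semidirect product of W by the boolean functions on W. *)
Require Import Defs.
From HB Require Import structures.
From mathcomp Require Import all_boot all_order all_algebra.
From mathcomp Require Import boolp classical_sets.
From mathcomp Require mpoly.

Set Implicit Arguments.
Unset Strict Implicit.
Unset Printing Implicit Defensive.

Import GRing.Theory.

(** * Monomial ideals and the lexicographic order *)

Module MonomialIdeals.
Import mpoly.
Local Open Scope classical_set_scope.
Local Open Scope ring_scope.

Section IdealGen.
Variable A : comNzRingType.
Implicit Types S T : set A.

Lemma mem_ideal_gen S p : S p -> ideal_gen S p.
Proof.
move=> Sp; exists [:: (1, p)]; split=> [c|].
  by rewrite mem_seq1 => /eqP ->; exact: Sp.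
by rewrite big_seq1 mul1r.
Qed.

Lemma ideal_gen_mul S q p : ideal_gen S p -> ideal_gen S (q * p).
Proof.
move=> [cs [csS ->]]; exists [seq (q * c.1, c.2) | c <- cs]; split.
  by move=> _ /mapP[c c_cs ->]; exact: (csS c).
by rewrite big_map mulr_sumr; apply: eq_bigr => c _; rewrite mulrA.
Qed.

Lemma ideal_gen_add S p q : ideal_gen S p -> ideal_gen S q -> ideal_gen S (p + q).
Proof.
move=> [cs [csS ->]] [ds [dsS ->]]; exists (cs ++ ds); rewrite big_cat; split => //.
by move=> c; rewrite mem_cat => /orP[/csS|/dsS].
Qed.

Lemma ideal_gen_sub S T :
  (forall p, S p -> ideal_gen T p) -> forall p, ideal_gen S p -> ideal_gen T p.
Proof.
move=> ST _ [cs [csS ->]]; rewrite big_seq.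
elim/big_ind: _ => [|p q|c /csS/ST Tc]; [|exact: ideal_gen_add|exact: ideal_gen_mul].
by exists [::]; rewrite big_nil.
Qed.

End IdealGen.

Section Monomials.
Variables (k : fieldType) (n : nat).

(** The coefficient of ['X_[v]] is nonzero in some term [c.1 * c.2] of the sum, and a multiple of
    ['X_[u]] involves only monomials divisible by ['X_[u]]. *)
Lemma mem_monomial_ideal (U : 'X_{1..n} -> Prop) (v : 'X_{1..n}) :
  ideal_gen [set p : {mpoly k[n]} | exists2 u, U u & p = 'X_[u]] 'X_[v] <->
  exists2 u, U u & (u <= v)%MM.
Proof.
split=> [[cs [csU v_sum]]|[u Uu /submK <-]]; last first.
  by rewrite mpolyXD; apply/ideal_gen_mul/mem_ideal_gen; exists u.
have [c c_cs cv] : exists2 c, c \in cs & (c.1 * c.2)@_v != 0.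
  apply/hasP; apply: contraT; rewrite -all_predC => /allP c0.
  have := mcoeffX k v v; rewrite eqxx v_sum raddf_sum /= big_seq.
  rewrite big1 => [/esym/eqP|c /c0 /=].
    by rewrite oner_eq0.
  by rewrite negbK => /eqP.
have [u Uu c_eq] := csU c c_cs; exists u => //; move: cv; rewrite c_eq.
apply: contraNT => uv; apply/eqP; apply: memN_msupp_eq0.
rewrite (perm_mem (msuppMX _ _)); apply: contra uv => /mapP[w _ ->].
exact: lem_addr.
Qed.

Lemma mem_mon_ideal (us : seq 'X_{1..n}) (v : 'X_{1..n}) :
  mon_ideal k us 'X_[v] <-> exists2 u, u \in us & (u <= v)%MM.
Proof. exact: (mem_monomial_ideal (fun u => u \in us)). Qed.

Lemma xmon_le (A B : {set 'I_n}) : (xmon A <= xmon B)%MM = (A \subset B).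
Proof.
apply/mnm_lepP/fintype.subsetP => [AB i iA|AB i].
  by have := AB i; rewrite !mnmE iA lt0b.
by rewrite !mnmE; case: (boolP (i \in A)) => // /AB ->.
Qed.

Lemma mem_stanley_reisner (L : {set {set 'I_n}}) (v : 'X_{1..n}) :
  stanley_reisner k L 'X_[v] <-> exists2 F, F \notin L & (xmon F <= v)%MM.
Proof.
rewrite /stanley_reisner.
have -> : [set p : {mpoly k[n]} | exists2 F, F \notin L & p = 'X_[xmon F]]
    = [set p | exists2 u, (exists2 F, F \notin L & u = xmon F) & p = 'X_[u]].
  apply/seteqP; split=> p /=.
    by move=> [F FL ->]; exists (xmon F) => //; exists F.
  by move=> [_ [F FL ->] ->]; exists F.
rewrite mem_monomial_ideal; split=> [[_ [F FL ->] Fv]|[F FL Fv]].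
  by exists F.
by exists (xmon F) => //; exists F.
Qed.

Lemma xmon_inj : injective (@xmon n).
Proof. by move=> A B AB; apply/eqP; rewrite finset.eqEsubset -!xmon_le AB !lepm_refl. Qed.

(** A generator divisible by another one could be dropped, so minimality makes [P] an antichain.
    Equality of the two ideals puts a member of [P] below every non-face and a non-face below every
    member of [P]; hence [P] consists of the minimal non-faces. *)
Lemma minimal_generators_stanley_reisner (L : {set {set 'I_n}}) (P : seq {set 'I_n}) :
  minimal_generators (stanley_reisner k L) [seq xmon F | F <- P] ->
  forall F, F \in P <-> F \notin L /\
    forall F' : {set 'I_n}, F' \subset F -> F' \notin L -> F' = F.
Proof.
move=> [gen minimal].
have below F : F \notin L -> exists2 F', F' \in P & F' \subset F.
  move=> FL; have : stanley_reisner k L 'X_[xmon F].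
    by apply/mem_stanley_reisner; exists F; rewrite ?lepm_refl.
  rewrite -gen => /mem_mon_ideal[_ /mapP[F' F'P ->]]; rewrite xmon_le => F'F.
  by exists F'.
have above F : F \in P -> exists2 F', F' \notin L & F' \subset F.
  move=> FP; have : mon_ideal k [seq xmon F | F <- P] 'X_[xmon F].
    by apply/mem_mon_ideal; exists (xmon F); rewrite ?lepm_refl ?map_f.
  by rewrite gen => /mem_stanley_reisner[F' F'L]; rewrite xmon_le; exists F'.
have antichain F F' : F \in P -> F' \in P -> F' \subset F -> F' = F.
  move=> FP F'P F'F; apply: contrapT => F'F_neq.
  pose vs := [seq u <- [seq xmon F | F <- P] | u != xmon F].
  have : {subset [seq xmon F | F <- P] <= vs}.
    apply: minimal => [u|]; first by rewrite mem_filter => /andP[].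
    rewrite -gen; apply/seteqP; split; apply: ideal_gen_sub => _ [u + ->].
      by rewrite mem_filter => /andP[_ uP]; apply: mem_ideal_gen; exists u.
    move=> uP; apply/mem_mon_ideal; have [->|uF] := eqVneq u (xmon F).
      exists (xmon F'); last by rewrite xmon_le.
      by rewrite mem_filter map_f // (inj_eq xmon_inj) andbT; apply/eqP.
    by exists u; rewrite ?lepm_refl // mem_filter uF.
  by move=> /(_ _ (map_f _ FP)); rewrite mem_filter eqxx.
move=> F; split=> [FP|[FL F_min]].
  have F_min (F' : {set 'I_n}) : F' \subset F -> F' \notin L -> F' = F.
    move=> F'F /below[G GP GF']; apply/eqP; rewrite finset.eqEsubset F'F.
    by rewrite -(antichain F G FP GP (fintype.subset_trans GF' F'F)).
  by split=> //; have [F' F'L F'F] := above F FP; rewrite -(F_min F').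
have [F' F'P F'F] := below F FL; have [G GL GF'] := above F' F'P.
have GF : G = F by apply: F_min GL; exact: fintype.subset_trans GF' F'F.
suff -> : F = F' by [].
by apply/eqP; rewrite finset.eqEsubset F'F andbT -GF.
Qed.

(** Divisibility of $x_j\mathbf x_{P_i}$ by the squarefree $\mathbf x_F$ depends on supports only,
    even when [j] lies in $P_i$ and has exponent 2 in the product. *)
Lemma mem_lin_set (P : seq {set 'I_n}) i j : (i < size P)%N ->
  reflect (exists2 F, F \in take i P & F \subset j |: nth finset.set0 P i)
    (j \in lin_set k [seq xmon F | F <- P] i).
Proof.
move=> iP; rewrite finset.in_set; apply: (iffP (asboolP _));
  rewrite /colon /= -mpolyXD -map_take.
  move/mem_mon_ideal => [_ /mapP[F FP ->]]; rewrite (nth_map finset.set0) // => F_le.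
  exists F => //; apply/fintype.subsetP => l lF; rewrite !inE.
  move/mnm_lepP/(_ l): F_le; rewrite mnmDE !mnmE lF.
  by rewrite eq_sym; case: eqVneq => //= _; rewrite add0n lt0b.
move=> [F FP /fintype.subsetP F_le]; apply/mem_mon_ideal; exists (xmon F).
  exact: map_f.
rewrite (nth_map finset.set0) //; apply/mnm_lepP => l; rewrite mnmDE !mnmE.
case: (boolP (l \in F)) => // /F_le; rewrite !inE => /orP[/eqP ->|->].
  by rewrite eqxx.
by rewrite addn1.
Qed.

Lemma lex_gt_xmon (A B : {set 'I_n}) : lex_gt (xmon A) (xmon B) ->
  exists2 i, i \in A :\: B & forall l : 'I_n, (l < i)%N -> (l \in A) = (l \in B).
Proof.
move=> /existsP[i /andP[/forallP eq_lt]]; rewrite !mnmE => BA; exists i.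
  by rewrite inE; move: BA; case: (i \in A); case: (i \in B).
move=> l li; have := implyP (eq_lt l) li; rewrite !mnmE.
by case: (l \in A); case: (l \in B).
Qed.

Lemma lex_gt_irr : irreflexive (@lex_gt n).
Proof. by move=> u; apply/existsP => -[i /andP[_]]; rewrite ltnn. Qed.

Lemma lex_gt_trans : transitive (@lex_gt n).
Proof.
move=> v u w /existsP[i /andP[/forallP uv uvi]] /existsP[j /andP[/forallP vw vwj]].
apply/existsP; have [ij|ji|/val_inj ij] := ltngtP i j.
- exists i; rewrite -(eqP (implyP (vw i) ij)) uvi andbT; apply/forallP => l.
  apply/implyP => li; rewrite (eqP (implyP (uv l) li)).
  exact: (implyP (vw l) (ltn_trans li ij)).
- exists j; rewrite (eqP (implyP (uv j) ji)) vwj andbT; apply/forallP => l.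
  apply/implyP => lj; rewrite (eqP (implyP (uv l) (ltn_trans lj ji))).
  exact: (implyP (vw l) lj).
rewrite -ij in vwj; exists i; rewrite (ltn_trans vwj uvi) andbT; apply/forallP => l.
apply/implyP => li; rewrite (eqP (implyP (uv l) li)).
by apply: (implyP (vw l)); rewrite -ij.
Qed.

Lemma sorted_lex_gt_last (s : seq {set 'I_n}) (A B : {set 'I_n}) :
  sorted (@lex_gt n) [seq xmon F | F <- rcons s B] -> A \in s ->
  lex_gt (xmon A) (xmon B).
Proof.
rewrite map_rcons (sorted_pairwise lex_gt_trans) pairwise_rcons => /andP[+ _] As.
by move=> /allP; apply; exact: map_f.
Qed.

Lemma sorted_lex_gt_uniq (P : seq {set 'I_n}) :
  sorted (@lex_gt n) [seq xmon F | F <- P] -> uniq P.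
Proof.
move=> /(sorted_uniq lex_gt_trans lex_gt_irr); exact: map_uniq.
Qed.

End Monomials.
End MonomialIdeals.

(** * A discrete Stokes formula *)

Section CubicalCochains.
Local Open Scope ring_scope.
Variables n p : nat.

Notation grid := {ffun 'I_n -> 'I_p.+1}.
Notation cochain := ({set 'I_n} -> grid -> 'F_2).

(* At the upper bound [p], [inord] wraps around to [0]. *)
Definition grid_up (i : 'I_n) (x : grid) : grid :=
  [ffun j => if j == i then inord (x j).+1 else x j].

Definition grid_down (i : 'I_n) (x : grid) : grid :=
  [ffun j => if j == i then inord (x j).-1 else x j].

(** A cochain takes the value [w S x] on the cube with lowest corner [x] and edge directions [S].
    Over $\mathbb F_2$ the usual signs disappear. *)
Definition coboundary (w : cochain) : cochain :=
  fun S x => \sum_(i in S) (w (S :\ i) (grid_up i x) + w (S :\ i) x).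

Variable l : 'I_n -> grid -> 'F_2.

(* The cup product of the coboundaries of the [l j], for [j] in [s]. *)
Definition cup_forms (s : seq 'I_n) : cochain :=
  foldr (fun j w => coboundary (fun S x => l j x * w S x))
        (fun S _ => (S == finset.set0)%:R) s.

Definition in_cell (S : {set 'I_n}) (x y : grid) : Prop :=
  forall j, y j = x j \/ j \in S /\ y j = inord (x j).+1.

Lemma addF2 (a : 'F_2) : a + a = 0.
Proof. by apply: addrr_pchar2; rewrite pchar_Fp. Qed.

Lemma grid_upC i j x : grid_up i (grid_up j x) = grid_up j (grid_up i x).
Proof.
apply/ffunP => k; rewrite !ffunE.
by case: (eqVneq k i) => [->|]; case: (eqVneq _ j).
Qed.

(** The contribution [f i j] of an ordered pair of directions is symmetric, so the pairs with
    [j < i] cancel those with [i < j]. *)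
Lemma coboundary_coboundary w S x : coboundary (coboundary w) S x = 0.
Proof.
pose f (i j : 'I_n) : 'F_2 := w (S :\ i :\ j) (grid_up j (grid_up i x))
  + w (S :\ i :\ j) (grid_up i x) + w (S :\ i :\ j) (grid_up j x)
  + w (S :\ i :\ j) x.
have -> : coboundary (coboundary w) S x =
    \sum_(i in S) \sum_(j in S :\ i) f i j.
  apply: eq_bigr => i _; rewrite -big_split /=; apply: eq_bigr => j _.
  by rewrite /f !addrA.
have fC i j : f i j = f j i.
  rewrite /f (_ : S :\ j :\ i = S :\ i :\ j) 1?grid_upC; last first.
    by apply/setP => k; rewrite !inE andbCA.
  by congr (_ + _); rewrite addrAC.
have fnat i : \sum_(j in S :\ i) f i j =
    \sum_(j in S | (j < i)%N) f i j + \sum_(j in S | (i < j)%N) f i j.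
  rewrite (bigID (fun j : 'I_n => (j < i)%N)) /=; congr (_ + _);
    by apply: eq_bigl => j; rewrite !inE -val_eqE /=; case: ltngtP; rewrite ?andbT ?andbF.
rewrite (eq_bigr _ (fun i _ => fnat i)).
rewrite big_split /= [X in _ + X](exchange_big_dep (mem S)) /=;
  last by move=> ? ? _ /andP[].
under [X in _ + X]eq_bigr => i Si.
  under eq_bigr do rewrite fC.
  rewrite (eq_bigl (fun j => (j \in S) && (j < i)%N)); last by move=> j /=; rewrite Si.
  over.
exact: addF2.
Qed.

Lemma coboundary_cup_forms s S x : coboundary (cup_forms s) S x = 0.
Proof.
case: s => [|j s]; last exact: coboundary_coboundary.
by rewrite /coboundary big1 // => i _; exact: addF2.
Qed.

(** The Leibniz rule: the term in which the coboundary falls on [cup_forms s] vanishes because that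
    cochain is closed. *)
Lemma cup_forms_cons j s S x : cup_forms (j :: s) S x =
  \sum_(i in S) (l j (grid_up i x) + l j x) * cup_forms s (S :\ i) (grid_up i x).
Proof.
rewrite -[RHS]addr0 -[X in _ = _ + X](mulr0 (l j x)).
rewrite -[X in _ = _ + _ * X](coboundary_cup_forms s S x).
rewrite /= {2}/coboundary mulr_sumr -big_split; apply: eq_bigr => i _ /=.
by rewrite mulrDl mulrDr -!addrA; congr (_ + _); rewrite addrA addF2 add0r.
Qed.

(** The factor coming from [l j] is a sum of its values at the two ends of an edge of the cell,
    hence zero. *)
Lemma cup_forms_const s j S x : j \in s ->
  (forall y, in_cell S x y -> l j y = l j x) -> cup_forms s S x = 0.
Proof.
elim: s S x => [|k0 s IH] S x; rewrite ?in_nil // inE => j_s l_const.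
have up_cell i : i \in S -> in_cell S x (grid_up i x).
  by move=> Si k; rewrite ffunE; case: eqP => [->|]; [right|left].
rewrite cup_forms_cons big1 // => i Si.
case/predU1P: j_s => [<-|j_s]; first by rewrite l_const ?addF2 ?mul0r //; exact: up_cell.
rewrite IH ?mulr0 // => y y_cell; rewrite [RHS]l_const; last exact: up_cell.
apply: l_const => k; have := y_cell k; rewrite ffunE.
case: eqP => [->|ki]; first by case=> [->|[]]; [right|rewrite !inE eqxx].
by case=> [->|[]]; [left|rewrite !inE => /andP[_ Sk] ->; right].
Qed.

(** Differences in direction [i] telescope, leaving the two end faces; the range [E] does not depend
    on the coordinate [i]. *)
Lemma sum_grid_shift (i : 'I_n) (E : pred grid) (h : grid -> 'F_2) :
  (forall x, E (grid_up i x) = E x) -> (forall x, E (grid_down i x) = E x) ->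
  \sum_(x | E x && (x i < p)%N) (h (grid_up i x) + h x) =
  \sum_(x | E x && (x i == ord_max)) h x + \sum_(x | E x && (x i == ord0)) h x.
Proof.
move=> Eup Edown.
have split_max : \sum_(x | E x) h x = \sum_(x | E x && (x i == ord_max)) h x
    + \sum_(x | E x && (x i < p)%N) h x.
  rewrite (bigID (fun x : grid => x i == ord_max)) /=; congr (_ + _).
  by apply: eq_bigl => x; rewrite -val_eqE /= ltn_neqAle -ltnS ltn_ord andbT.
have split_0 : \sum_(x | E x) h x = \sum_(x | E x && (x i == ord0)) h x
    + \sum_(x | E x && (0 < x i)%N) h x.
  rewrite (bigID (fun x : grid => x i == ord0)) /=; congr (_ + _).
  by apply: eq_bigl => x; rewrite -val_eqE /= lt0n.
have -> : \sum_(x | E x && (x i < p)%N) (h (grid_up i x) + h x) =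
    \sum_(x | E x && (0 < x i)%N) h x + \sum_(x | E x && (x i < p)%N) h x.
  rewrite big_split /=; congr (_ + _).
  rewrite [RHS](reindex_onto (grid_up i) (grid_down i)) /=; last first.
    move=> x /andP[_ xi0]; apply/ffunP => j; rewrite !ffunE.
    case: eqP => // ->; apply: val_inj; rewrite /=.
    have xi : ((x i).-1 < p.+1)%N by rewrite (leq_ltn_trans (leq_pred _)).
    by rewrite (inordK xi) prednK // inordK.
  apply: eq_bigl => x; rewrite Eup -andbA; congr (_ && _).
  rewrite ffunE eqxx; case: ltnP => [xi|xi].
    rewrite inordK ?ltnS //; apply/esym/eqP/ffunP => j; rewrite !ffunE.
    by case: eqP => [->|//]; rewrite (@inordK p (x i).+1) ?ltnS //= inord_val.
  have /negPf xi1 : ~~ ((x i).+1 < p.+1)%N by rewrite ltnS -leqNgt.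
  by rewrite val_insubd /= xi1.
have addF2K (a b c : 'F_2) : a = b + c -> b = a + c by move->; rewrite -addrA addF2 addr0.
by rewrite (addF2K _ _ _ split_max) (addF2K _ _ _ split_0) addrACA addF2 add0r addrC.
Qed.

Hypothesis l0 : forall i (x : grid), x i = ord0 -> l i x = 0.
Hypothesis l1 : forall i (x : grid), x i = ord_max -> l i x = 1.

(** Descending induction on [k] by Stokes on the face whose coordinates below [k] are maximal. In
    direction [k] the lower end contributes 0 by [l0], and the upper end contributes the sum for
    [k.+1] by [l1]. In a direction [i > k], [l i] is constant on both ends and kills the cup product
    there. *)
Lemma sum_cup_forms k : (k <= n)%N ->
  \sum_(x : grid | [forall j : 'I_n, if (k <= j)%N then (x j < p)%N else x j == ord_max])
    cup_forms (drop k (enum 'I_n)) [set j : 'I_n | (k <= j)%N] x = 1.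
Proof.
move=> kn; rewrite -(subKn kn); elim: (n - k)%N (leq_subr k n) => [_|m IH mn].
  rewrite subn0 drop_oversize ?size_enum_ord //=.
  rewrite (big_pred1 [ffun=> ord_max]) => [|x].
    rewrite (_ : finset _ = finset.set0) ?eqxx //.
    by apply/setP => j; rewrite !inE leqNgt ltn_ord.
  apply/forallP/eqP => [x_max|-> j]; last by rewrite leqNgt ltn_ord ffunE /=.
  by apply/ffunP => j; have := x_max j; rewrite leqNgt ltn_ord ffunE /= => /eqP.
set q := (n - m.+1)%N; have qn : (q < n)%N by rewrite ltn_subrL (leq_trans _ mn).
have qS : (n - m)%N = q.+1 by rewrite /q -subSn // subSS.
pose i0 := Ordinal qn.
have -> : drop q (enum 'I_n) = i0 :: drop q.+1 (enum 'I_n).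
  rewrite (drop_nth i0) ?size_enum_ord //; congr (_ :: _).
  by apply: val_inj; rewrite /= nth_enum_ord.
have {IH} := IH (ltnW mn); rewrite qS; set s := drop _ _ => IH.
set S := finset _; rewrite /= /coboundary exchange_big /=.
pose E (i : 'I_n) (x : grid) := [forall j : 'I_n, (j == i) ||
  if (q <= j)%N then (x j < p)%N else x j == ord_max].
have boxE i (x : grid) : i \in S ->
    [forall j : 'I_n, if (q <= j)%N then (x j < p)%N else x j == ord_max]
    = E i x && (x i < p)%N.
  rewrite inE => qi; apply/forallP/andP => [x_box|[/forallP x_E xi] j].
    by split; [apply/forallP => j; rewrite x_box orbT|have := x_box i; rewrite qi].
  by have := x_E j; case: (eqVneq j i) => [->|] //=; rewrite qi.
have E_up i (x y : grid) : (forall j, j != i -> x j = y j) -> E i x = E i y.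
  by move=> xy; apply: eq_forallb => j; case: (eqVneq j i) => //= /xy ->.
have sum_shift i (h : grid -> 'F_2) : i \in S ->
    \sum_(x : grid |
        [forall j : 'I_n, if (q <= j)%N then (x j < p)%N else x j == ord_max])
      (h (grid_up i x) + h x) =
    \sum_(x | E i x && (x i == ord_max)) h x + \sum_(x | E i x && (x i == ord0)) h x.
  move=> iS; rewrite (eq_bigl _ _ (fun x => boxE i x iS));
    apply: (@sum_grid_shift i (E i) h);
    by move=> x; apply: E_up => j ji; rewrite ffunE (negPf ji).
have i0S : i0 \in S by rewrite inE.
have qltE (j : 'I_n) : (q < j)%N = (j != i0) && (q <= j)%N.
  by rewrite ltn_neqAle eq_sym.
rewrite (bigD1 i0) //= [X in _ + X]big1 ?addr0 => [|i /andP[iS ii0]].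
  rewrite (sum_shift i0 (fun x => l i0 x * cup_forms s (S :\ i0) x)) //.
  rewrite [X in _ + X]big1 ?addr0 => [|x /andP[_ /eqP xi0]]; last by rewrite l0 ?mul0r.
  rewrite -IH; apply: eq_big => [x|x /andP[_ /eqP xi0]].
    apply/andP/forallP => [[/forallP x_E /eqP xi] j|x_box].
      by have := x_E j; rewrite qltE; case: eqVneq => //= ->; rewrite xi.
    split; last by have := x_box i0; rewrite ltnn.
    by apply/forallP => j; have := x_box j; rewrite qltE; case: eqVneq.
  rewrite l1 // mul1r; congr cup_forms; apply/setP => j; rewrite !inE.
  by rewrite qltE.
have qi : (q < i)%N by move: iS; rewrite inE qltE ii0.
have i_s : i \in s.
  rewrite /s; apply/(nthP i0); exists (i - q.+1)%N.
    by rewrite size_drop size_enum_ord ltn_sub2r // (leq_ltn_trans qi).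
  by rewrite nth_drop subnKC // nth_ord_enum.
rewrite (sum_shift i (fun x => l i0 x * cup_forms s (S :\ i) x)) //.
have cst (x : grid) c : x i = c -> (c == ord_max) || (c == ord0) ->
    cup_forms s (S :\ i) x = 0.
  move=> xi c_bd; apply: (cup_forms_const i_s) => y y_cell.
  have yi : y i = x i by have := y_cell i; rewrite !inE eqxx /=; case=> [->|[]].
  by case/orP: c_bd => /eqP c_eq; [rewrite !l1|rewrite !l0]; rewrite ?yi ?xi.
by rewrite !big1 ?addr0 // => x /andP[_ /eqP xi]; rewrite (cst _ _ xi) ?eqxx ?orbT ?mulr0.
Qed.

(** A combinatorial Poincare-Miranda theorem: the total is 1, so the cup product is nonzero on some
    cell, and there no [l i] can be constant. *)
Lemma cubical_cell : exists x : grid,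
  (forall i, x i < p)%N /\
  forall i, exists2 y : grid,
    (forall j, y j = x j \/ y j = (x j).+1 :> nat) & l i y != l i x.
Proof.
have := sum_cup_forms (leq0n n); rewrite drop0.
set S := finset _ => sum1.
have [x /forallP x_box x_cell] : exists2 x : grid,
    [forall j : 'I_n, if (0 <= j)%N then (x j < p)%N else x j == ord_max] &
    cup_forms (enum 'I_n) S x != 0.
  apply/exists_inP; rewrite -negb_forall_in; apply/negP => /forall_inP sum0.
  by move/eqP: sum1; rewrite big1 // => x /sum0/eqP.
exists x; split=> [i|i]; first exact: x_box.
apply: contrapT => l_const; move/eqP: x_cell; apply.
apply: (@cup_forms_const _ i) => [|y y_cell]; first by rewrite mem_enum.
apply: contrapT => /eqP ne; apply: l_const; exists y => // j.
by case: (y_cell j) => [->|[_ ->]]; [left|right; rewrite inordK // ltnS x_box].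
Qed.

End CubicalCochains.

From mathcomp Require Import all_classical all_reals all_analysis.
From mathcomp Require Import lra.
Import MonomialIdeals.
Import Order.TTheory GRing.Theory Num.Theory numFieldNormedType.Exports.

(** * Star-shaped sets are not spheres *)

Section Brouwer.
Local Open Scope classical_set_scope.
Local Open Scope ring_scope.
Variable R : realType.

Lemma norm_coord m (x : 'rV[R]_m) i : `|x 0 i| <= `|x|.
Proof.
rewrite [leRHS]/Num.norm /= mx_normrE; apply/bigmax_geP; right => /=.
by exists (0, i).
Qed.

Lemma norm_rV_le m (x : 'rV[R]_m) e :
  0 <= e -> (forall i, `|x 0 i| <= e) -> `|x| <= e.
Proof.
move=> e0 xe; rewrite [leLHS]/Num.norm /= mx_normrE (bigmax_le _ e0) //=.
by move=> [i j] _ /=; rewrite ord1.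
Qed.

Lemma cvg_rV m T (F : set_system T) {FF : Filter F} (f : T -> 'rV[R]_m) (l : 'rV[R]_m) :
  (forall i, (fun t => f t 0 i) @ F --> l 0 i) -> f @ F --> l.
Proof.
move=> fl A [P lP sPA]; rewrite /= /nbhs /=.
apply: filterS (_ : \forall t \near F, forall i, P 0 i (f t 0 i)).
  by move=> t Pt; apply: sPA => i j; rewrite ord1.
by apply: filter_forall => i; exact/fl/lP.
Qed.

Lemma cvg_within_range {T} {U : topologicalType} (F : set_system T) {FF : Filter F}
    (A : set U) (f : T -> U) (l : U) :
  (\forall t \near F, A (f t)) -> f @ F --> l -> f @ F --> within A (nbhs l).
Proof.
move=> fA fl W Wl; have {}fl := fl _ Wl.
by apply: filterS2 fA fl => t ? /(_ _); apply.
Qed.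

Lemma cvg_barycenter n T (F : set_system T) {FF : Filter F} (s : T -> R)
    (f : T -> 'rV[R]_n) (c : 'rV[R]_n) (t : R) (l : 'rV[R]_n) :
  s @ F --> t -> f @ F --> l ->
  (fun x => s x *: f x + (1 - s x) *: c) @ F --> t *: l + (1 - t) *: c.
Proof.
move=> st fl; apply: cvgD; apply: cvgZ => //; last exact: cvg_cst.
by apply: cvgB => //; exact: cvg_cst.
Qed.

(** The norm on row vectors is the maximum norm, so its unit ball is the cube $[-1,1]^m$. *)
Definition cube m : set 'rV[R]_m := [set x | `|x| <= 1].

Lemma compact_cube m : compact (@cube m).
Proof.
apply: bounded_closed_compact.
  by exists 1; split => // M M1 x /le_trans; apply; exact: ltW.
rewrite (_ : @cube m = Num.norm @^-1` [set x : R | x <= 1]) //.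
apply: preimage_closed; last exact: closed_le.
by move=> x _; exact: norm_continuous.
Qed.

(** Without a zero, compactness yields a mesh so fine that near each point some coordinate of [g]
    keeps its sign. Labelling the grid points by the signs of the coordinates of [g] then
    contradicts [cubical_cell]. *)
Lemma poincare_miranda m (g : 'rV[R]_m -> 'rV[R]_m) :
  {within @cube m, continuous g} ->
  (forall x i, cube x -> x 0 i = - 1 -> g x 0 i < 0) ->
  (forall x i, cube x -> x 0 i = 1 -> 0 < g x 0 i) ->
  exists2 x, cube x & g x = 0.
Proof.
move=> /subspace_continuousP gc gN gP; apply: contrapT => no_zero.
(* The radius [2 / k.+1%:R] is the side of a cell when $[-1,1]$ is cut into [k.+1] intervals. *)
pose same_sign k (x : 'rV[R]_m) := cube x -> exists i, forall y, cube y ->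
  `|x - y| <= 2 / k.+1%:R -> (0 < g y 0 i) = (0 < g x 0 i).
have : \forall k \near \oo, @cube m `<=` same_sign k.
  have near_cube := (compact_near_coveringP _).1 (@compact_cube m).
  apply: near_cube => x cx.
  have [i gi0] : exists i, g x 0 i != 0.
    apply: contrapT => g0; apply: no_zero; exists x => //; apply/rowP => i.
    by rewrite mxE; apply: contrapT => /eqP gi; apply: g0; exists i.
  have gic : (fun y => g y 0 i) @ within (@cube m) (nbhs x) --> g x 0 i.
    exact: (cvg_comp _ _ (gc x cx) (@coord_continuous _ _ _ 0 i (g x))).
  have : \forall y \near x, cube y -> (0 < g y 0 i) = (0 < g x 0 i).
    move: gi0; rewrite neq_lt => /orP[gi0|gi0].
      have := cvgr_lt _ gic _ gi0 => /(_ (within_filter _ _)); rewrite near_withinE.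
      by apply: filterS => y gy /gy gy0; rewrite !ltNge (ltW gy0) (ltW gi0).
    have := cvgr_gt _ gic _ gi0 => /(_ (within_filter _ _)); rewrite near_withinE.
    by apply: filterS => y gy /gy gy0; rewrite gy0 gi0.
  move=> /nbhs_ballP[d /= d0 d_sgn].
  have d20 : 0 < d / 2 by rewrite divr_gt0.
  have d40 : 0 < d / 2 / 2 by rewrite divr_gt0.
  (* Halving leaves room for the triangle inequality: both [x'] and any [y] close to it stay in the
     ball of radius [d] around [x]. *)
  exists (ball x (d / 2), [set k | 2 / k.+1%:R < d / 2]) => /=.
    split; first exact: nbhsx_ballx.
    have := near_infty_natSinv_lt (PosNum d40).
    by apply: filterS => k /=; rewrite ltr_pdivlMr // mulrC.
  move=> [x' k] /= [xx' kd] cx'; exists i => y cy x'y.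
  rewrite d_sgn ?d_sgn //.
    by apply: (le_ball _ xx'); rewrite ler_pdivrMr // ler_peMr ?ler1n // ltW.
  move: xx'; rewrite -!ball_normE /= => xx'.
  rewrite (splitr d) (le_lt_trans (ler_distD x' _ _)) // ltrD //.
  exact: le_lt_trans x'y kd.
move=> [k _ /(_ k (leqnn k)) sgn]; clear -sgn gN gP.
pose pt (a : {ffun 'I_m -> 'I_k.+2}) : 'rV[R]_m :=
  \row_i (2 * ((a i)%:R / k.+1%:R) - 1).
pose l i a : 'F_2 := (0 < g (pt a) 0 i)%R%:R.
have k0 : (0 : R) < k.+1%:R by rewrite ltr0n.
have ptE a i : pt a 0 i = 2 * ((a i)%:R / k.+1%:R) - 1 by rewrite mxE.
have pt_cube a : cube (pt a).
  apply: norm_rV_le => // i; rewrite ptE ler_norml.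
  have : (a i)%:R <= k.+1%:R :> R by rewrite ler_nat -ltnS.
  rewrite -[X in _ <= X]mul1r -ler_pdivrMr // => a1.
  have a0 : 0 <= (a i)%:R / k.+1%:R :> R by rewrite divr_ge0.
  by move: a0 a1; set t := (a i)%:R / _ => a0 a1; apply/andP; split; lra.
have [i a ai|i a ai|a [_ a_cell]] := @cubical_cell m k.+1 l.
- rewrite /l ltNge ltW // gN // ptE ai /= mul0r mulr0 sub0r //.
- by rewrite /l gP // ptE ai /= divff ?gt_eqF // mulr1; lra.
have [i i_sgn] := sgn _ (pt_cube a) (pt_cube a); have [b ab] := a_cell i.
move/eqP; apply; rewrite /l i_sgn //; apply: norm_rV_le; first by rewrite divr_ge0.
move=> j; rewrite !mxE /= opprB addrA subrK -mulrBr -mulrBl normrM.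
rewrite (ger0_norm (ler0n R 2)) ler_wpM2l // normrM normfV normr_nat.
rewrite ler_piMl ?invr_ge0 //.
case: (ab j) => ->; first by rewrite subrr normr0.
by rewrite -[(a j).+1%:R]natr1 opprD addrA subrr add0r normrN1.
Qed.

(** The Euclidean norm, needed because [unit_sphere] is Euclidean while the ambient norm is the
    maximum norm. *)
Definition enorm m (x : 'rV[R]_m) : R := Num.sqrt (\sum_i x 0 i ^+ 2).

Lemma enorm_continuous m : continuous (@enorm m).
Proof.
have sqr_sum_cont : continuous (fun x : 'rV[R]_m => \sum_i x 0 i ^+ 2).
  apply: continuous_big => [|i _ x]; first exact: add_continuous.
  exact: (cvg_comp _ _ (@coord_continuous R 1 m 0 i x) (@exprn_continuous R 2 (x 0 i))).
move=> x; apply: (continuous_comp (sqr_sum_cont x)); exact: sqrt_continuous.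
Qed.

Lemma sum_sqr_ge0 m (x : 'rV[R]_m) : 0 <= \sum_i x 0 i ^+ 2.
Proof. by apply: sumr_ge0 => i _; exact: sqr_ge0. Qed.

Lemma enorm_gt0 m (x : 'rV[R]_m) : x != 0 -> 0 < enorm x.
Proof.
move=> x0; rewrite sqrtr_gt0 lt_neqAle sum_sqr_ge0 andbT eq_sym.
apply: contra x0 => /eqP /psumr_eq0P x2; apply/eqP/rowP => i.
by rewrite mxE; apply/eqP; rewrite -sqrf_eq0 x2 // => j _; exact: sqr_ge0.
Qed.

Lemma unit_sphere_normalize m (x : 'rV[R]_m) :
  x != 0 -> unit_sphere ((enorm x)^-1 *: x).
Proof.
move=> x0; rewrite /unit_sphere /=; under eq_bigr do rewrite mxE exprMn.
rewrite -mulr_sumr exprVn sqr_sqrtr ?sum_sqr_ge0 // mulVf //.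
by rewrite gt_eqF // -sqrtr_gt0 enorm_gt0.
Qed.

Lemma unit_sphere_enorm m (x : 'rV[R]_m) : unit_sphere x -> enorm x = 1.
Proof. by rewrite /enorm => ->; exact: sqrtr1. Qed.

Lemma unit_sphere_neq0 m (x : 'rV[R]_m) : unit_sphere x -> x != 0.
Proof.
apply: contraPneq => ->; rewrite /unit_sphere /= big1 => [/esym/eqP|i _].
  by rewrite oner_eq0.
by rewrite mxE expr0n.
Qed.

(* A homeomorphism onto the sphere would turn the straight-line contraction of
   the star-shaped set to its centre into a retraction of the cube onto the
   sphere. *)
Lemma starshaped_not_sphere n m (A : set 'rV[R]_n) (c : 'rV[R]_n) (M : R) :
  A c -> (forall x, A x -> `|x| <= M) ->
  (forall x t, A x -> 0 <= t <= 1 -> A (t *: x + (1 - t) *: c)) ->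
  ~ homeomorphic A (@unit_sphere R m).
Proof.
move=> Ac A_bd A_star [f [g [fg gf f_cont g_cont]]].
(* The cone extension of [g] to the cube: 0 goes to [c], and a boundary point goes to the image
   under [g] of its radial projection. At 0 the meaningless value of [g] is multiplied by 0. *)
pose q (x : 'rV[R]_m) := `|x| *: g ((enorm x)^-1 *: x) + (1 - `|x|) *: c.
have qA x : cube x -> A (q x).
  move=> cx; have [->|x0] := eqVneq x 0.
    by rewrite /q normr0 scale0r add0r subr0 scale1r.
  apply: A_star; last by rewrite normr_ge0.
  by have [] := gf _ (unit_sphere_normalize x0).
have q_cont x : cube x -> q @ within (@cube m) (nbhs x) --> q x.
  move=> cx; have [->|x0] := eqVneq x 0.
    have M0 : 0 <= M by apply: le_trans (A_bd _ Ac).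
    apply: cvg_within_filter; apply/cvgrPdist_lt => e e0; apply/nbhs_ballP.
    (* [M + |c|] bounds the distance from [c] to the points of [A]; the added 1 keeps the
       denominator positive. *)
    have eM0 : 0 < e / (M + `|c| + 1) by rewrite divr_gt0 // ltr_wpDl // addr_ge0.
    exists (e / (M + `|c| + 1)) => //= y; rewrite -ball_normE /= sub0r normrN.
    have [->|y0] := eqVneq y 0.
      by move=> _; rewrite subrr normr0.
    have gy : `|g ((enorm y)^-1 *: y)| <= M.
      by apply: A_bd; have [] := gf _ (unit_sphere_normalize y0).
    rewrite ltr_pdivlMr ?ltr_wpDl ?addr_ge0 //; apply: le_lt_trans.
    have -> : q 0 - q y = `|y| *: (c - g ((enorm y)^-1 *: y)).
      rewrite /q normr0 scale0r add0r subr0 scale1r scalerBr scalerBl scale1r.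
      by rewrite addrCA opprD addrA subrr add0r opprB.
    rewrite normrZ normr_id ler_wpM2l //.
    rewrite (le_trans (ler_normD _ _)) // normrN addrC -addrA lerD // lerDl.
    exact: ler01.
  have norm_x : Num.norm @ within (@cube m) (nbhs x) --> `|x|.
    by apply: cvg_within_filter; exact: norm_continuous.
  have g_norm : (fun y => g ((enorm y)^-1 *: y)) @ within (@cube m) (nbhs x)
      --> g ((enorm x)^-1 *: x).
    apply: cvg_comp
      (proj1 (subspace_continuousP _ _) g_cont _ (unit_sphere_normalize x0)).
    apply: cvg_within_range.
      have xP : 0 < `|x| by rewrite normr_gt0.
      have := cvgr_gt _ norm_x _ xP => /(_ (within_filter _ _)).
      by apply: filterS => y; rewrite normr_gt0 => /unit_sphere_normalize.
    apply: cvg_within_filter; apply: cvgZ; last exact: cvg_id.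
    by apply: cvgV; [rewrite gt_eqF // enorm_gt0|exact: enorm_continuous].
  exact: (cvg_barycenter norm_x g_norm).
have q_bd x i : cube x -> `|x 0 i| = 1 -> f (q x) = (enorm x)^-1 *: x /\ 0 < (enorm x)^-1.
  move=> cx xi; have x1 : `|x| = 1.
    by apply/eqP; rewrite eq_le cx -xi norm_coord.
  have x0 : x != 0 by rewrite -normr_eq0 x1 oner_eq0.
  rewrite /q x1 subrr scale0r addr0 scale1r invr_gt0 enorm_gt0 //.
  by have [_ ->] := gf _ (unit_sphere_normalize x0).
(* On the boundary of the cube [f \o q] is a positive rescaling, so it has the signs required. The
   zero obtained contradicts that its values lie on the sphere. *)
have [|x i cx xi|x i cx xi|x cx fx] := @poincare_miranda m (f \o q).
- apply/subspace_continuousP => x cx.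
  apply: cvg_comp _ (proj1 (subspace_continuousP _ _) f_cont _ (qA x cx)).
  apply: cvg_within_range (q_cont x cx).
  by rewrite near_withinE; apply: nearW => y; exact: qA.
- have [|/= -> en] := q_bd x i cx; first by rewrite xi normrN1.
  by rewrite mxE xi mulrN1 oppr_lt0.
- have [|/= -> en] := q_bd x i cx; first by rewrite xi normr1.
  by rewrite mxE xi mulr1.
by have := unit_sphere_neq0 (fg _ (qA _ cx)).1; rewrite -[f (q x)]/((f \o q) x) fx eqxx.
Qed.

End Brouwer.

(** * The boundary of a simplex *)

Section SimplexBoundary.
Local Open Scope classical_set_scope.
Local Open Scope ring_scope.
Variables (R : realType) (n : nat) (V : {set 'I_n}) (v : 'I_n).
Hypothesis vV : v \in V.

Let m := #|(V :\ v)%SET|.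
Let e (j : 'I_m) : 'I_n := enum_val j.

Implicit Types (x : 'rV[R]_n) (y : 'rV[R]_m).

Lemma mem_vertex j : e j \in V.
Proof. by have := enum_valP j; rewrite inE => /andP[]. Qed.

Lemma vertex_neq j : e j != v.
Proof. by have := enum_valP j; rewrite !inE => /andP[]. Qed.

Lemma vertexP i : i \in V -> i = v \/ exists j, i = e j.
Proof.
have [->|iv] := eqVneq i v; [by left|move=> iV; right].
have iVv : i \in (V :\ v)%SET by rewrite !inE iv.
by exists (enum_rank_in iVv i); rewrite /e enum_rankK_in.
Qed.

(* [flat] subtracts the coordinate at [v] and drops it; [bent] inverts it by adding
   the constant that makes the smallest coordinate of the simplex vanish. *)
Let flat (x : 'rV[R]_n) : 'rV[R]_m := \row_j (x 0 (e j) - x 0 v).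

(** The initial value 0 stands for the coordinate at [v], which [flat] turns into 0 and drops. *)
Let low (y : 'rV[R]_m) : R := \big[Num.min/0]_j y 0 j.

Let bent (y : 'rV[R]_m) : 'rV[R]_n :=
  \row_i ((i \in V)%:R * (\sum_j (e j == i)%:R * y 0 j - low y)).

Let total (x : 'rV[R]_n) : R := \sum_i x 0 i.

Lemma bent_v y : bent y 0 v = - low y.
Proof.
rewrite mxE vV mul1r big1 ?sub0r // => j _.
by rewrite (negPf (vertex_neq j)) mul0r.
Qed.

Lemma bent_vertex y j : bent y 0 (e j) = y 0 j - low y.
Proof.
rewrite mxE mem_vertex mul1r (bigD1 j) //= eqxx mul1r big1 ?addr0 // => k kj.
by rewrite (inj_eq enum_val_inj) (negPf kj) mul0r.
Qed.

Lemma bent_out y i : i \notin V -> bent y 0 i = 0.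
Proof. by rewrite mxE => /negPf ->; rewrite mul0r. Qed.

Lemma low_le0 y : low y <= 0.
Proof. exact: bigmin_le_id. Qed.

Lemma low_le y j : low y <= y 0 j.
Proof. exact: bigmin_le_cond. Qed.

Lemma low_attained y : low y = 0 \/ exists j, low y = y 0 j.
Proof.
rewrite /low; elim/big_ind: _ => [|a b [->|[j ->]] [->|[k ->]]|j _];
  rewrite ?minEle; try case: ifP; by [left|right; eexists].
Qed.

Lemma low_unique y t : t <= 0 -> (forall j, t <= y 0 j) ->
  t = 0 \/ (exists j, t = y 0 j) -> low y = t.
Proof.
move=> t0 ty t_att; apply/eqP; rewrite eq_le; apply/andP; split.
  by case: t_att => [->|[j ->]]; [exact: low_le0|exact: low_le].
by case: (low_attained y) => [->|[j ->]].
Qed.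

Lemma bent_scale a y : 0 <= a -> bent (a *: y) = a *: bent y.
Proof.
move=> a0; have low_scale : low (a *: y) = a * low y.
  apply: low_unique => [|j|].
  - by rewrite mulr_ge0_le0 ?low_le0.
  - by rewrite mxE ler_wpM2l ?low_le.
  - case: (low_attained y) => [->|[j ->]]; first by left; rewrite mulr0.
    by right; exists j; rewrite mxE.
apply/rowP => i; rewrite !mxE low_scale [RHS]mulrCA [a * (_ - _)]mulrBr mulr_sumr.
congr (_ * (_ - _)).
by apply: eq_bigr => j _; rewrite mxE mulrCA.
Qed.

Lemma bent_ge0 y i : 0 <= bent y 0 i.
Proof.
have [iV|iV] := boolP (i \in V); last by rewrite bent_out.
case: (vertexP iV) => [->|[j ->]]; first by rewrite bent_v oppr_ge0 low_le0.
by rewrite bent_vertex subr_ge0 low_le.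
Qed.

Lemma bent_vanishes y : exists2 i, i \in V & bent y 0 i = 0.
Proof.
case: (low_attained y) => [y0|[j yj]].
  by exists v; rewrite ?bent_v ?y0 ?oppr0.
by exists (e j); rewrite ?mem_vertex ?bent_vertex ?yj ?subrr.
Qed.

Lemma total_bent_gt0 y : y != 0 -> 0 < total (bent y).
Proof.
move=> y0; rewrite lt_neqAle sumr_ge0 => [|i _]; last exact: bent_ge0.
rewrite andbT eq_sym; apply: contra y0 => /eqP /psumr_eq0P bent0.
have {}bent0 i : bent y 0 i = 0 by apply: bent0 => // k _; exact: bent_ge0.
have low0 : low y = 0 by apply/eqP; rewrite -oppr_eq0 -bent_v bent0.
by apply/eqP/rowP => j; rewrite mxE -[LHS](subr0) -{1}low0 -bent_vertex bent0.
Qed.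

Lemma flat_scale a x : flat (a *: x) = a *: flat x.
Proof. by apply/rowP => j; rewrite !mxE mulrBr. Qed.

Lemma flat_bent y : flat (bent y) = y.
Proof. by apply/rowP => j; rewrite mxE bent_v bent_vertex opprK subrK. Qed.

Let bd : {set {set 'I_n}} := [set F : {set 'I_n} | F \proper V]%SET.

(** Some coordinate of [x] in [V] vanishes and the others are nonnegative, so the minimum of 0 and
    the differences $x_i-x_v$ is $-x_v$; subtracting it restores [x]. *)
Lemma bent_flat x : realization bd x -> bent (flat x) = x.
Proof.
move=> [x_ge0 _]; rewrite inE properE => /andP[/fintype.subsetP x_supp x_miss].
have x_out i : i \notin V -> x 0 i = 0.
  by move=> iV; apply/eqP; apply: contraNT iV => xi; apply: x_supp; rewrite inE.
have [i iV xi] : exists2 i, i \in V & x 0 i = 0.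
  move/fintype.subsetPn: x_miss => [i iV]; rewrite inE negbK => /eqP xi.
  by exists i.
have low_flat : low (flat x) = - x 0 v.
  apply: low_unique => [|j|].
  - by rewrite oppr_le0.
  - by rewrite mxE lerDr.
  - case: (vertexP iV) xi => [->|[j ->]] xi; first by left; rewrite xi oppr0.
    by right; exists j; rewrite mxE xi sub0r.
apply/rowP => k; have [kV|kV] := boolP (k \in V); last by rewrite bent_out ?x_out.
case: (vertexP kV) => [->|[j ->]]; first by rewrite bent_v low_flat opprK.
by rewrite bent_vertex low_flat mxE opprK subrK.
Qed.

Lemma flat_neq0 x : realization bd x -> flat x != 0.
Proof.
move=> xA; apply: contraPneq (bent_flat xA) => flat0.
case: xA => _ sum1 _ bentx; move: sum1; rewrite -bentx flat0 big1 => [/eqP|i _].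
  by rewrite eq_sym oner_eq0.
by have := bent_scale 0 (lexx 0); rewrite !scale0r => ->; rewrite mxE.
Qed.

Lemma enorm_scale k a (y : 'rV[R]_k) : 0 <= a -> enorm (a *: y) = a * enorm y.
Proof.
move=> a0; rewrite /enorm; under eq_bigr do rewrite mxE exprMn.
by rewrite -mulr_sumr sqrtrM ?sqr_ge0 // sqrtr_sqr ger0_norm.
Qed.

Lemma total_scale a x : total (a *: x) = a * total x.
Proof. by rewrite /total mulr_sumr; under eq_bigr do rewrite mxE. Qed.

Lemma normalize_bent_realization y :
  y != 0 -> realization bd ((total (bent y))^-1 *: bent y).
Proof.
move=> /total_bent_gt0 tot_gt0; split.
- by move=> i; rewrite mxE mulr_ge0 ?bent_ge0 // invr_ge0 ltW.
- by rewrite -/(total _) total_scale mulVf // gt_eqF.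
rewrite inE properE; apply/andP; split.
  apply/fintype.subsetP => i; rewrite inE; apply: contraR => iV.
  by rewrite mxE bent_out // mulr0.
have [i iV bent0] := bent_vanishes y.
by apply/fintype.subsetPn; exists i => //; rewrite inE mxE bent0 mulr0 eqxx.
Qed.

(** [flat] and [bent] are mutually inverse and compatible with nonnegative scaling. Normalizing by
    the Euclidean norm on one side and by the coordinate sum on the other gives inverse
    homeomorphisms. *)
Lemma simplex_boundary_sphere :
  homeomorphic (@realization R n bd) (@unit_sphere R m).
Proof.
exists (fun x => (enorm (flat x))^-1 *: flat x).
exists (fun y => (total (bent y))^-1 *: bent y).
split.
- move=> x xA; split; first exact/unit_sphere_normalize/flat_neq0.
  have fx_gt0 : 0 < enorm (flat x) by exact/enorm_gt0/flat_neq0.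
  rewrite bent_scale ?invr_ge0 1?ltW // bent_flat // total_scale.
  have -> : total x = 1 by case: xA.
  by rewrite mulr1 invrK scalerA divff ?scale1r // gt_eqF.
- move=> y y1; have y0 := unit_sphere_neq0 y1.
  have tot_gt0 := total_bent_gt0 y0.
  split; first exact: normalize_bent_realization.
  rewrite flat_scale flat_bent enorm_scale ?invr_ge0 1?ltW //.
  by rewrite (unit_sphere_enorm y1) mulr1 invrK scalerA divff ?scale1r // gt_eqF.
- apply/subspace_continuousP => x xA; apply: cvg_within_filter.
  have flat_cont : flat @ nbhs x --> flat x.
    apply: cvg_rV => j; rewrite mxE; under eq_cvg do rewrite mxE.
    by apply: cvgB; exact: coord_continuous.
  apply: cvgZ => //; apply: cvgV; first by rewrite gt_eqF // enorm_gt0 // flat_neq0.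
  by apply: cvg_comp flat_cont _; exact: enorm_continuous.
- apply/subspace_continuousP => y y1; apply: cvg_within_filter.
  have y0 := unit_sphere_neq0 y1.
  have low_cont : low @ nbhs y --> low y.
    apply: (@cvg_big _ _ Num.min) => [|j _]; last exact: coord_continuous.
    exact: min_continuous.
  have bent_cont : bent @ nbhs y --> bent y.
    apply: cvg_rV => i; rewrite mxE; under eq_cvg do rewrite mxE.
    apply: cvgM; first exact: cvg_cst.
    apply: cvgB => //; apply: (@cvg_big _ _ +%R) => [|j _]; first exact: add_continuous.
    by apply: cvgM; [exact: cvg_cst|exact: coord_continuous].
  apply: cvgZ => //; apply: cvgV; first by rewrite gt_eqF // total_bent_gt0.
  apply: (@cvg_big _ _ +%R) => [|i _]; first exact: add_continuous.
  exact: (cvg_comp _ _ bent_cont (@coord_continuous R 1 n 0 i (bent y))).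
Qed.

End SimplexBoundary.

(** * The exchange condition *)

Section CocycleGroup.
Local Open Scope group_scope.
Variable W : groupType.

(* The semidirect product of the boolean functions on [W] by [W], acting
   through conjugation. *)
Definition cocycle_group : Type := ((W -> bool) * W)%type.

HB.instance Definition _ := Choice.on cocycle_group.

Implicit Types a b : cocycle_group.

Definition cocycle_one : cocycle_group := (fun=> false, 1).

Definition cocycle_inv a : cocycle_group := (fun r => a.1 (r ^ a.2^-1), a.2^-1).

Definition cocycle_mul a b : cocycle_group :=
  (fun r => a.1 r (+) b.1 (r ^ a.2), a.2 * b.2).

Lemma cocycle_mulA : associative cocycle_mul.
Proof.
move=> a b c; congr (_, _); last exact: mulgA.
by apply/funext => r /=; rewrite addbA conjgM.
Qed.

Lemma cocycle_mul1g : left_id cocycle_one cocycle_mul.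
Proof.
case=> h w; congr (_, _); last exact: mul1g.
by apply/funext => r /=; rewrite conjg1.
Qed.

Lemma cocycle_mulg1 : right_id cocycle_one cocycle_mul.
Proof.
case=> h w; congr (_, _); last exact: mulg1.
by apply/funext => r /=; rewrite addbF.
Qed.

Lemma cocycle_mulVg : left_inverse cocycle_one cocycle_inv cocycle_mul.
Proof.
by case=> h w; congr (_, _); [apply/funext => r /=; rewrite addbb|exact: mulVg].
Qed.

Lemma cocycle_mulgV : right_inverse cocycle_one cocycle_inv cocycle_mul.
Proof.
case=> h w; congr (_, _); last exact: mulgV.
by apply/funext => r /=; rewrite conjgK addbb.
Qed.

HB.instance Definition _ := isGroup.Build cocycle_group cocycle_mulA
  cocycle_mul1g cocycle_mulg1 cocycle_mulVg cocycle_mulgV.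

End CocycleGroup.

Section Exchange.
Local Open Scope group_scope.
Local Open Scope classical_set_scope.
Variables (W : groupType) (Sig : set W).
Hypothesis coxW : coxeter_system Sig.

(** With the indicator of [s] as first component, the product along a word records, modulo 2, the
    reflections $s_1\cdots s_{i-1}s_is_{i-1}\cdots s_1$ attached to it. *)
Definition reflection_gen (s : W) : cocycle_group W := (fun r => r == s, s).

Lemma gen_sqr s : Sig s -> s * s = 1.
Proof.
by case: coxW => m [m1 _ mrel _ _] Ss; have := mrel s s Ss Ss; rewrite m1.
Qed.

(** The elements $(st)^js$ with $j<2k$ are the reflections attached to the word $stst\cdots$ of
    length $2k$; conjugation by $s$ and then $t$ shifts [j] by 2. *)
Lemma reflection_gen_exp s t k : s * s = 1 -> t * t = 1 ->
  (reflection_gen s * reflection_gen t) ^+ k =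
  (fun r => \big[addb/false]_(0 <= j < k.*2) (r == (s * t) ^+ j * s),
   (s * t) ^+ k) :> cocycle_group W.
Proof.
move=> ss tt; have sV : s^-1 = s by exact: mulg1_eq.
have tV : t^-1 = t by exact: mulg1_eq.
elim: k => [|k IH].
  by rewrite !expg0; congr (_, _); apply/funext => r; rewrite big_geq.
rewrite [LHS]expgS IH expgS; congr (_, _); apply/funext => r /=.
rewrite doubleS !big_nat_recl // addbA; congr (_ (+) _ (+) _).
- by rewrite expg0 mul1g.
- rewrite expg1 conjgE sV; apply/eqP/eqP => [<-|->].
    by rewrite !mulgA ss mul1g -mulgA ss mulg1.
  by rewrite -!mulgA ss mulg1 !mulgA ss mul1g.
apply: eq_bigr => j _; rewrite conjgE.
set x := s * t; have xs : x * s = s * x^-1 by rewrite invgM sV tV mulgA.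
rewrite -(inj_eq (mulgI x)) mulVKg -(inj_eq (mulIg x^-1)) mulgK.
by rewrite !mulgA -expgS -mulgA -xs mulgA -expgSr.
Qed.

(** Since $(st)^{m}=1$ for $m=m(s,t)$, the $2m$ reflections $(st)^js$ repeat with period $m$ and
    cancel modulo 2. Thus [reflection_gen] respects the relations and extends to [W]; [N w r] is the
    parity with which [r] occurs for any word of [w]. *)
Lemma parity_cocycle : exists N : W -> W -> bool,
  (forall s r, Sig s -> N s r = (r == s)) /\
  (forall v w r, N (v * w) r = N v r (+) N w (r ^ v)).
Proof.
case: coxW => m [m1 msym mrel gen univ].
have [|phi [phiM phi_gen]] := univ (cocycle_group W) reflection_gen.
  move=> s t Ss St; rewrite reflection_gen_exp ?gen_sqr //.
  have st1 := mrel s t Ss St.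
  congr (_, _) => //; apply/funext => r.
  rewrite -addnn (big_cat_nat (n := m s t)) ?leq_addr //=.
  rewrite -{2}[m s t]add0n big_addn addnK.
  under [X in _ (+) X]eq_bigr do rewrite expgnDr st1 mulg1.
  by rewrite addbb.
have phi2 w : (phi w).2 = w.
  have phi1 : phi 1 = 1 by apply: (mulgI (phi 1)); rewrite -phiM !mulg1.
  have [ws ws_gen ->] := gen w; elim: ws ws_gen => [|s ws IH] ws_gen.
    by rewrite big_nil phi1.
  rewrite big_cons phiM phi_gen; last by apply: ws_gen; rewrite mem_head.
  by rewrite /= IH // => t t_ws; apply: ws_gen; rewrite inE t_ws orbT.
exists (fun w => (phi w).1); split=> [s r Ss|v w r]; first by rewrite phi_gen.
by rewrite phiM /= phi2.
Qed.

Local Notation prod := (fun ws => \prod_(x <- ws) x).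

(** If [N (prod c) s] holds, then [s] is a reflection attached to [c], and multiplying by it deletes
    a letter. Otherwise [N (prod b) s] holds, and deleting a letter of [b] expresses [prod c] by
    fewer than [size c] letters. *)
Lemma exchange s (c b : seq W) :
  Sig s -> (forall x, x \in c -> Sig x) -> (forall x, x \in b -> Sig x) ->
  s * prod c = prod b -> (size b <= size c)%N ->
  (forall l, expressible Sig (prod c) l -> (size c <= l)%N) ->
  exists2 p, (p < size c)%N & s * prod c = prod (take p c ++ drop p.+1 c).
Proof.
move=> Ss c_gen b_gen sc bc c_red.
have [N [N_gen NM]] := parity_cocycle.
have N_true (ws : seq W) r : (forall x, x \in ws -> Sig x) -> N (prod ws) r ->
    exists2 p, (p < size ws)%N & r * prod (take p ws) = prod (take p.+1 ws).
  elim: ws r => [|x ws IH] r ws_gen.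
    have N1 : N 1 r = false by have := NM 1 1 r; rewrite mul1g conjg1; case: (N 1 r).
    by rewrite big_nil N1.
  have Sx : Sig x by apply: ws_gen; rewrite mem_head.
  rewrite big_cons NM N_gen //; have [-> _|_ /=] := eqVneq r x.
    by exists 0; rewrite //= take0 big_nil big_seq1 mulg1.
  move=> /IH[y y_ws|p p_lt rp]; first by apply: ws_gen; rewrite inE y_ws orbT.
  exists p.+1 => //=.
  by rewrite !big_cons -rp conjgE !mulgA mulgV mul1g.
have delete (ws : seq W) : (forall x, x \in ws -> Sig x) -> N (prod ws) s ->
    exists2 p, (p < size ws)%N & s * prod ws = prod (take p ws ++ drop p.+1 ws).
  move=> ws_gen /N_true[] // p p_lt sp; exists p => //.
  rewrite -{1}(cat_take_drop p.+1 ws) !big_cat /= -sp !mulgA.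
  by rewrite gen_sqr // mul1g.
apply: (delete c) => //; apply: contraT => Nc.
have Nb : N (prod b) s by rewrite -sc NM N_gen // eqxx conjgE mulKg (negPf Nc).
have [p pb] := delete b b_gen Nb.
rewrite -sc mulgA gen_sqr // mul1g => c_short.
have := c_red (size b).-1; rewrite leqNgt prednK ?bc; last exact: leq_ltn_trans pb.
apply; exists (take p b ++ drop p.+1 b); split => //.
  by move=> x; rewrite mem_cat => /orP[/mem_take|/mem_drop]; exact: b_gen.
rewrite size_cat size_takel 1?ltnW // size_drop; apply: succn_inj.
by rewrite -addnS subnSK // subnKC 1?ltnW // prednK // (leq_ltn_trans _ pb).
Qed.

End Exchange.

(** * Subword complexes *)

Lemma coxlen_le (W : groupType) (Sig : set W) (w : W) (l : nat) :
  expressible Sig w l -> (coxlen Sig w <= l)%N.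
Proof.
move=> wl; have ex : exists l, `[< expressible Sig w l >] by exists l; apply/asboolP.
have [l0 /asboolP l0_expr l0_min] := ex_minnP ex.
rewrite /coxlen; case: xgetP => [l1 -> [_ l1_min]|]; first exact: l1_min.
move=> /(_ l0)[]; split=> // l' /asboolP; exact: l0_min.
Qed.

(** * Products of subwords and exchanges of positions *)

Section Words.
Variables (W : groupType) (Sig : set W) (n : nat) (Q : n.-tuple W).
Local Open Scope group_scope.
Implicit Types S F : {set 'I_n}.

Definition word_prod S : W := \prod_(s <- letters Q S) s.

Lemma size_letters S : size (letters Q S) = #|S|.
Proof. by rewrite size_map cardE. Qed.

Lemma representsE F pi :
  represents Sig Q F pi = (word_prod F == pi) && (#|F| == coxlen Sig pi).
Proof. by rewrite /represents size_letters. Qed.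

Definition before (i : 'I_n) S := [set l in S | (l < i)%N].
Definition after (i : 'I_n) S := [set l in S | (i < l)%N].

Lemma enum_split i S :
  enum S = enum (before i S) ++ [seq l <- enum S | l == i] ++ enum (after i S).
Proof.
have filterE (A : pred 'I_n) : enum [set l in S | A l] = [seq l <- enum S | A l].
  rewrite /enum_mem -filter_predI; apply: eq_filter => l.
  by rewrite /= !inE andbC.
rewrite /before /after !filterE.
have lt_trans : transitive (fun l l' : 'I_n => (l < l')%N).
  by move=> ? ? ?; exact: ltn_trans.
have : sorted (fun l l' : 'I_n => (l < l')%N) (enum S).
  rewrite /enum_mem sorted_filter //; have := iota_ltn_sorted 0 n.
  by rewrite -val_enum_ord sorted_map enumT.
elim: (enum S) => //= l s IH l_s; have /(order_path_min lt_trans) l_min := l_s.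
rewrite {1}(IH (path_sorted l_s)).
have above : (i <= l)%N ->
    [seq x : 'I_n <- s | (x < i)%N] = [::] /\ [seq x : 'I_n <- s | x == i] = [::].
  move=> il; split; apply/eqP; rewrite -(negbK (_ == _)) -has_filter -all_predC;
    apply: sub_all l_min => x /= lx; first by rewrite -leqNgt ltnW // (leq_ltn_trans il).
  by rewrite -val_eqE gtn_eqF // (leq_ltn_trans il).
rewrite -(val_eqE l i); have [li|il|li] := ltngtP l i => //=.
- by have [] := above (ltnW il) => -> ->.
- by have [] := above (eq_leq (esym li)) => -> ->.
Qed.

Lemma word_prod_split i S : word_prod S =
  word_prod (before i S) * (if i \in S then tnth Q i else 1) * word_prod (after i S).
Proof.
rewrite /word_prod /letters {1}(enum_split i) !map_cat !big_cat -mulgA /=.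
congr (_ * (_ * _)); rewrite big_map; case: ifP => iS.
  rewrite (_ : [seq l <- enum S | l == i] = [:: i]) ?big_seq1 //.
  by rewrite (@eq_filter _ _ (pred1 i)) // filter_pred1_uniq ?enum_uniq ?mem_enum.
rewrite big_filter big_seq_cond big_pred0 // => l; rewrite mem_enum.
by case: eqP => [->|]; rewrite ?iS ?andbF.
Qed.

Lemma letters_delete S q : (q < #|S|)%N ->
  exists2 x, x \in S &
    take q (letters Q S) ++ drop q.+1 (letters Q S) = letters Q (S :\ x).
Proof.
move=> qS; have [x0 x0S] : exists x0, x0 \in S.
  by apply/card_gt0P; exact: leq_ltn_trans qS.
have qe : (q < size (enum S))%N by rewrite -cardE.
exists (nth x0 (enum S) q); first by rewrite -mem_enum mem_nth.
rewrite /letters -map_take -map_drop -map_cat; congr map.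
have -> : enum (S :\ nth x0 (enum S) q) = rem (nth x0 (enum S) q) (enum S).
  rewrite rem_filter ?enum_uniq // /enum_mem -filter_predI; apply: eq_filter => x.
  by rewrite !inE.
by rewrite remE index_uniq ?enum_uniq.
Qed.

Hypothesis hQ : is_word Sig Q.

Lemma letters_gen S x : x \in letters Q S -> Sig x.
Proof. by move=> /mapP[i _ ->]. Qed.

Hypothesis coxW : coxeter_system Sig.
Variable pi : W.

Lemma represents_swap F i p : p \in F -> i \notin F ->
  represents Sig Q F pi -> word_prod (i |: (F :\ p)) = pi ->
  represents Sig Q (i |: (F :\ p)) pi.
Proof.
rewrite !representsE => pF iF /andP[_ /eqP F_card] ->; rewrite eqxx -F_card.
by rewrite cardsU1 !inE (negPf iF) andbF (cardsD1 p F) pF eqxx.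
Qed.

(** Positions before [i] are untouched because [i < p], so their common product cancels on the
    left. *)
Lemma word_prod_swap F (i p : 'I_n) : i \notin F -> (i < p)%N ->
  word_prod F = word_prod (i |: (F :\ p)) <->
  word_prod (after i F) = tnth Q i * word_prod (after i F :\ p).
Proof.
move=> iF ip; rewrite (word_prod_split i) [RHS](word_prod_split i).
rewrite (negPf iF) !inE eqxx mulg1 -mulgA.
have -> : before i (i |: (F :\ p)) = before i F.
  apply/setP => l; rewrite !inE; case: (ltnP l i) => li; rewrite ?andbF // !andbT.
  by rewrite -!(val_eqE l) !ltn_eqF // (ltn_trans li).
have -> : after i (i |: (F :\ p)) = after i F :\ p.
  apply/setP => l; rewrite !inE -(val_eqE l i) /=.
  by case: ltngtP; rewrite ?andbF ?andbT.
by split=> [/mulgI|->].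
Qed.

(* Exchanging the later of the two positions [i < j] into the word that uses the
   other one yields a reduced word which the hypotheses on [P0] exclude, unless
   both exchanges remove the same letter. *)
Lemma exchanged_position_unique (P0 : {set 'I_n}) (i j p q : 'I_n) :
  represents Sig Q P0 pi ->
  (forall F, represents Sig Q F pi -> #|F :\: P0| <= 1)%N ->
  (forall F, represents Sig Q F pi -> i \in F -> F = i |: (P0 :\ p)) ->
  i \notin P0 -> j \notin P0 -> p \in P0 -> q \in P0 ->
  (i < j)%N -> (i < p)%N -> (j < q)%N ->
  represents Sig Q (i |: (P0 :\ p)) pi -> represents Sig Q (j |: (P0 :\ q)) pi ->
  p = q.
Proof.
set Fi := i |: _; set Fj := j |: _.
move=> P0_rep P0_near Fi_uniq iP jP pP qP ij ip jq Fi_rep Fj_rep.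
have prodE F : represents Sig Q F pi -> word_prod F = pi.
  by rewrite representsE => /andP[/eqP].
have [pj|jp|/val_inj pj] := ltngtP p j; last by rewrite -pj pP in jP.
  (* As [p < j], the sets [Fi] and [P0] agree after [j], so trading [q] for [j] also works in [Fi].
     The result has the two new positions [i] and [j], against [P0_near]. *)
  pose F' := j |: (Fi :\ q).
  have qFi : q \in Fi.
    by rewrite !inE qP -!val_eqE /= !gtn_eqF ?orbT // (ltn_trans _ jq).
  have jFi : j \notin Fi by rewrite !inE (negPf jP) andbF orbF -val_eqE gtn_eqF.
  have after_Fi : after j Fi = after j P0.
    apply/setP => l; rewrite !inE; case: (ltnP j l) => jl; rewrite ?andbF // !andbT.
    by rewrite -!(val_eqE l) /= !gtn_eqF // (ltn_trans _ jl).
  have F'_rep : represents Sig Q F' pi.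
    apply: represents_swap => //; rewrite -(prodE _ Fi_rep).
    apply/esym/word_prod_swap => //; rewrite after_Fi.
    by apply/word_prod_swap => //; rewrite !prodE.
  have := P0_near F' F'_rep; rewrite leqNgt => /negP[].
  apply/card_gt1P; exists i, j; split; last by rewrite -val_eqE ltn_eqF.
    rewrite !inE iP eqxx /= -!val_eqE /= (ltn_eqF ij) (@ltn_eqF i q) ?orbT //.
    exact: ltn_trans jq.
  by rewrite !inE jP eqxx.
have iFj : i \notin Fj by rewrite !inE (negPf iP) andbF orbF -val_eqE ltn_eqF.
have before_Fj : before i Fj = before i P0.
  apply/setP => l; rewrite !inE; case: (ltnP l i) => li; rewrite ?andbF // !andbT.
  have lj := ltn_trans li ij; by rewrite -!(val_eqE l) /= !ltn_eqF // (ltn_trans lj).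
have after_Fj : word_prod (after i Fj) = word_prod (after i P0).
  have := prodE _ P0_rep; rewrite -(prodE _ Fj_rep).
  rewrite (word_prod_split i P0) (word_prod_split i Fj).
  by rewrite before_Fj (negPf iP) (negPf iFj) => /mulgI.
have gen_i := hQ i.
have after_Fi : word_prod (after i P0) = tnth Q i * word_prod (after i P0 :\ p).
  by apply/word_prod_swap => //; rewrite !prodE.
(* The part of [Fj] after [i] has the same product as that of [P0], so multiplying it by the letter
   at [i] gives the product of the shorter word [after i P0 :\ p]. *)
have [|||||q0 q0_lt] := @exchange W Sig coxW (tnth Q i) (letters Q (after i Fj))
  (letters Q (after i P0 :\ p)) gen_i.
- by move=> x; exact: letters_gen.
- by move=> x; exact: letters_gen.
- by rewrite -/(word_prod _) after_Fj after_Fi mulgA (gen_sqr coxW) ?mul1g.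
- have pA : p \in after i P0 by rewrite inE pP.
  have qA : q \in after i P0 by rewrite inE qP (ltn_trans ij).
  rewrite !size_letters.
  have -> : #|after i P0 :\ p| = #|after i P0 :\ q|.
    by have := cardsD1 p (after i P0); rewrite (cardsD1 q (after i P0)) pA qA => -[].
  apply/subset_leq_card/fintype.subsetP => l; rewrite !inE => /and3P[-> -> ->].
  by rewrite orbT.
(* A suffix of a reduced word is reduced: a shorter expression would shorten the word of [Fj]. *)
- move=> l [ws [ws_gen ws_prod <-]].
  have : (coxlen Sig pi <= size (letters Q (before i Fj) ++ ws))%N.
    apply: coxlen_le; exists (letters Q (before i Fj) ++ ws); split => //.
      by move=> x; rewrite mem_cat => /orP[|/ws_gen //]; exact: letters_gen.
    rewrite big_cat /= -ws_prod -(prodE _ Fj_rep) (word_prod_split i Fj).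
    by rewrite (negPf iFj) mulg1.
  move: Fj_rep; rewrite representsE => /andP[_ /eqP <-].
  rewrite size_cat !size_letters -(cardsID (before i Fj) Fj).
  have -> : Fj :&: before i Fj = before i Fj.
    by apply/finset.setIidPr/fintype.subsetP => x; rewrite inE => /andP[].
  have -> : Fj :\: before i Fj = after i Fj.
    apply/setP => x; rewrite [LHS]inE [x \in after i Fj]inE inE.
    case: (boolP (x \in Fj)) => [xFj|]; rewrite ?andbF //= andbT -leqNgt.
    rewrite leq_eqVlt -[RHS]orFb; congr (_ || _).
    by rewrite (val_eqE i x); apply/negbTE; apply: contraNneq iFj => ->.
  by rewrite leq_add2l.
rewrite size_letters in q0_lt; have [x x_after ->] := letters_delete q0_lt.
rewrite -!/(word_prod _) => swap_x.
have [ix xFj] : (i < x)%N /\ x \in Fj by move: x_after; rewrite inE => /andP[].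
have F'_rep : represents Sig Q (i |: (Fj :\ x)) pi.
  apply: represents_swap => //; rewrite -(prodE _ Fj_rep).
  apply/esym/word_prod_swap => //.
  by rewrite -swap_x mulgA (gen_sqr coxW) ?mul1g.
(* The position [q] is absent from [i |: (Fj :\ x)], which equals [i |: (P0 :\ p)]; as [q] lies in
   [P0], it must be [p]. *)
have := Fi_uniq _ F'_rep; rewrite setU11 => /(_ isT)/setP/(_ q).
have qi : (q == i) = false by rewrite -val_eqE gtn_eqF // (ltn_trans ij).
have qj : (q == j) = false by rewrite -val_eqE gtn_eqF.
by rewrite !inE qi qj eqxx qP /= !andbF andbT; case: eqVneq.
Qed.

End Words.

(** * Cones over a vertex *)

Section Cone.
Local Open Scope ring_scope.
Variables (R : realType) (n : nat) (K : {set {set 'I_n}}) (v : 'I_n).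
Hypothesis K_complex : simplicial_complex K.
Hypothesis K_cone : forall G, G \in K -> v |: G \in K.

(** The realization is star-shaped around the vertex [v]: along a segment to [v] the support only
    gains [v], and so remains a face. *)
Lemma cone_not_sphere m : ~ homeomorphic (@realization R n K) (@unit_sphere R m).
Proof.
case: K_complex => K0 K_down.
apply: (@starshaped_not_sphere _ _ _ _ (delta_mx 0 v) 1) => [|x [x_ge0 x_sum _]|x t].
- split=> [i||].
  + by rewrite mxE eqxx ler0n.
  + rewrite (bigD1 v) //= mxE !eqxx big1 ?addr0 // => i iv.
    by rewrite mxE (negPf iv) andbF.
  apply: (K_down (v |: finset.set0)); first exact: K_cone.
  apply/fintype.subsetP => i; rewrite !inE mxE eqxx /=.
  by case: (i == v); rewrite ?eqxx.
- apply: norm_rV_le => // i; rewrite ger0_norm // -x_sum (bigD1 i) //= lerDl.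
  by apply: sumr_ge0.
move=> [x_ge0 x_sum x_supp] /andP[t0 t1]; split=> [i||].
- by rewrite !mxE addr_ge0 // mulr_ge0 // ?subr_ge0 ?ler0n.
- under eq_bigr do rewrite !mxE.
  rewrite big_split /= -!mulr_sumr x_sum mulr1 (bigD1 v) //= eqxx.
  rewrite [X in (1 - t) * (_ + X)]big1 => [|i /negPf -> //].
  by rewrite addr0 mulr1 addrC subrK.
apply: (K_down _ _ (K_cone x_supp)); apply/fintype.subsetP => i.
rewrite !inE !mxE eqxx /=; have [//|iv] := eqVneq i v.
by rewrite mulr0 addr0; apply: contraNneq => ->; rewrite mulr0.
Qed.

End Cone.

(** * Faces and generators of the subword complex *)

Section SubwordComplex.
Variables (W : groupType) (Sig : set W) (n : nat) (Q : n.-tuple W) (pi : W).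
Implicit Types F G : {set 'I_n}.

Local Notation rep F := (represents Sig Q F pi).
Local Notation Delta := (subword_complex Sig Q pi).

Lemma containsP F :
  reflect (exists2 F' : {set 'I_n}, F' \subset F & rep F') (contains Sig Q F pi).
Proof.
by apply: (iffP existsP) => [[F' /andP[]]|[F' ? ?]]; exists F' => //; apply/andP.
Qed.

Lemma mem_subword_complex G : (G \in Delta) = contains Sig Q (~: G) pi.
Proof.
apply/imsetP/idP => [[F + ->]|G_contains]; first by rewrite inE finset.setCK.
by exists (~: G); rewrite ?inE ?finset.setCK.
Qed.

Lemma subword_complexP G :
  reflect (exists2 F : {set 'I_n}, rep F & [disjoint F & G]) (G \in Delta).
Proof.
rewrite mem_subword_complex; apply: (iffP (containsP _)) => [[F FG repF]|[F repF FG]];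
  by exists F; rewrite ?finset.disjoints_subset in FG *.
Qed.

Lemma subword_complex_simplicial :
  contains Sig Q [set: 'I_n]%SET pi -> simplicial_complex Delta.
Proof.
move=> Qpi; split=> [|G G' /subword_complexP[F repF FG] G'G].
  by rewrite mem_subword_complex finset.setC0.
by apply/subword_complexP; exists F => //; apply: disjointWr FG.
Qed.

Lemma represents_card F : rep F -> #|F| = coxlen Sig pi.
Proof. by rewrite representsE => /andP[_ /eqP]. Qed.

(** The non-faces of the Alexander dual are the subwords containing [pi]. The minimal ones are those
    representing [pi], since these all have the same size. *)
Lemma mem_minimal_generators (k : fieldType) (P : seq {set 'I_n}) :
  minimal_generators (stanley_reisner k (alexander_dual Delta)) [seq xmon F | F <- P] ->
  forall F, (F \in P) = rep F.
Proof.
move=> /minimal_generators_stanley_reisner memP F.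
have dualE G : (G \notin alexander_dual Delta) = contains Sig Q G pi.
  rewrite -[in RHS](finset.setCK G) -mem_subword_complex -[RHS]negbK; congr (~~ _).
  apply/imsetP/idP => [[H + ->]|GD]; first by rewrite inE finset.setCK.
  by exists (~: G); rewrite ?inE ?finset.setCK.
apply/idP/idP => [/memP[]|repF].
  rewrite dualE => /containsP[F' F'F repF'] F_min.
  by rewrite -(F_min F') // dualE; apply/containsP; exists F'.
apply/memP; split=> [|F' F'F]; first by rewrite dualE; apply/containsP; exists F.
rewrite dualE => /containsP[F'' F''F' repF'']; apply/eqP.
rewrite eqEcard F'F (represents_card repF) -(represents_card repF'').
exact: subset_leq_card.
Qed.

(** * The generators seen from the last one *)

Section Facets.
Variables (k : fieldType) (P : seq {set 'I_n}).
Hypothesis memP : forall F, (F \in P) = rep F.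
Hypothesis P_lex : sorted (@lex_gt n) [seq xmon F | F <- P].
Hypothesis P_neq0 : (0 < size P)%N.

(** With indices counted from 0, this is $P_r$, and [J] below is $\mathrm{set}(\mathbf x_{P_r})$. *)
Let P0 := nth finset.set0 P (size P).-1.
Let J := lin_set k [seq xmon F | F <- P] (size P).-1.

Lemma facets_rcons : P = rcons (take (size P).-1 P) P0.
Proof.
rewrite -{1}(cat_take_drop (size P).-1 P) -cats1; congr (_ ++ _).
by rewrite (drop_nth finset.set0) ?prednK // drop_oversize.
Qed.

Lemma last_facet : rep P0.
Proof. by rewrite -memP mem_nth ?prednK. Qed.

Lemma facets_uniq : uniq P.
Proof. exact: sorted_lex_gt_uniq P_lex. Qed.

(** The witness [F] lies in [j |: P0], differs from [P0] because the list has no repetition, and has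
    the same size; so it must contain [j]. *)
Lemma lin_setP j : j \in J ->
  exists F, [/\ F \in take (size P).-1 P, rep F & F :\: P0 = [set j]%SET].
Proof.
move=> /mem_lin_set[]; first by rewrite prednK.
rewrite -/P0 => F F_take F_sub.
have repF : rep F by rewrite -memP; exact: mem_take F_take.
exists F; split=> //.
have F_neq : F != P0.
  apply: contraTneq F_take => ->; have := facets_uniq.
  by rewrite {1}facets_rcons rcons_uniq => /andP[].
have sub1 : F :\: P0 \subset [set j]%SET.
  apply/fintype.subsetP => l; rewrite !inE => /andP[lP0 /(fintype.subsetP F_sub)].
  by rewrite !inE (negPf lP0) orbF.
have /orP[/eqP //|] : (F :\: P0 == [set j]%SET) || (F :\: P0 == finset.set0).
  by rewrite -finset.subset1.
rewrite finset.setD_eq0 => FP0; case/negP: F_neq.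
by rewrite eqEcard FP0 (represents_card repF) (represents_card last_facet) leqnn.
Qed.

Hypothesis J_card : #|J| = (size P).-1.

(** A count: the singletons of [J] are $r-1$ values of the map [F :\: P0] on the $r-1$ earlier sets,
    so the map is injective and has no other values. *)
Lemma facets_near_last :
  {in [set F in take (size P).-1 P] &, injective (fun F => F :\: P0)} /\
  forall F, rep F -> F != P0 -> exists2 j, j \in J & F :\: P0 = [set j]%SET.
Proof.
set T := finset _; pose phi F := F :\: P0.
have take_uniq : uniq (take (size P).-1 P) by exact/take_uniq/facets_uniq.
have T_card : #|T| = (size P).-1.
  by rewrite cardsE (card_uniqP take_uniq) size_takel // leq_pred.
have J_sub : [set [set j]%SET | j in J]%SET \subset phi @: T.
  apply/fintype.subsetP => _ /imsetP[j /lin_setP[F [F_take _ Fj]] ->].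
  by apply/imsetP; exists F; rewrite ?inE.
have J_im : #|[set [set j]%SET | j in J]%SET| = #|T|.
  by rewrite card_imset ?J_card ?T_card //; exact: finset.set1_inj.
have phi_card : #|phi @: T| = #|T|.
  by apply/eqP; rewrite eqn_leq leq_imset_card -{1}J_im subset_leq_card.
split; first by apply/imset_injP; rewrite phi_card.
move=> F repF F_neq; have FT : F \in T.
  by move: repF; rewrite -memP {1}facets_rcons mem_rcons in_cons (negPf F_neq) inE.
have : phi F \in [set [set j]%SET | j in J]%SET.
  suff -> : [set [set j]%SET | j in J]%SET = phi @: T by rewrite imset_f.
  by apply/eqP; rewrite eqEcard J_sub phi_card J_im /=.
by move=> /imsetP[j jJ phiF]; exists j.
Qed.

Lemma lin_set_disjoint j : j \in J -> j \notin P0.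
Proof. by move=> /lin_setP[F [_ _ /setP/(_ j)]]; rewrite !inE eqxx => /andP[]. Qed.

(** Equal sizes force exactly one position [p] to be given up. As [F] is lexicographically larger,
    the first difference belongs to [F], so [j] precedes [p]. *)
Lemma facets_swap F : rep F -> F != P0 -> exists (j p : 'I_n),
  [/\ j \notin P0, p \in P0, (j < p)%N, F :\: P0 = [set j]%SET & F = j |: (P0 :\ p)].
Proof.
move=> repF F_neq; have [_ /(_ F repF F_neq)[j jJ Fj]] := facets_near_last.
have jP0 := lin_set_disjoint jJ.
have /eqP/cards1P[p P0p] : #|P0 :\: F| = 1%N.
  apply/eqP; rewrite -(eqn_add2l #|P0 :&: F|) cardsID finset.setIC.
  rewrite (represents_card last_facet) -(represents_card repF).
  by rewrite -(cardsID P0 F) Fj cards1.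
have : p \in P0 :\: F by rewrite P0p inE.
rewrite inE => /andP[pF pP0].
have F_take : F \in take (size P).-1 P.
  by move: repF; rewrite -memP {1}facets_rcons mem_rcons in_cons (negPf F_neq).
have F_lex : lex_gt (xmon F) (xmon P0).
  by apply: sorted_lex_gt_last F_take; rewrite -facets_rcons.
exists j, p; split=> //.
  have [i] := lex_gt_xmon F_lex; rewrite Fj => /set1P -> same.
  rewrite ltnNge leq_eqVlt; apply/negP => /orP[/eqP/val_inj pj|/same].
    by rewrite -pj pP0 in jP0.
  by rewrite pP0 (negPf pF).
apply/setP => l; move/setP/(_ l): Fj; move/setP/(_ l): P0p; rewrite !inE => <- <-.
by case: (l \in F); case: (l \in P0).
Qed.

(** Every representing set is contained in the union of [P0] and [J], so [v] lies in all the
    complementary facets. *)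
Lemma facets_cone v G : v \notin P0 -> v \notin J -> G \in Delta -> v |: G \in Delta.
Proof.
move=> vP0 vJ /subword_complexP[F repF FG]; apply/subword_complexP; exists F => //.
rewrite finset.disjoints_subset; apply/fintype.subsetP => l lF.
rewrite !inE negb_or (disjointFr FG lF) andbT; apply: contraTneq lF => -> {l}.
have [-> //|F_neq] := eqVneq F P0.
have [_ /(_ F repF F_neq)[j jJ Fj]] := facets_near_last.
apply: contra vJ => vF; suff -> : v = j by [].
by apply/set1P; rewrite -Fj inE vP0.
Qed.

(** Once all exchanges give up the same [p], put [V = p |: ~: P0]. The representing sets are the
    [x |: ~: V] with [x] in [V], so the facets are [V] with one vertex removed. *)
Lemma facets_simplex_boundary j0 :
  coxeter_system Sig -> is_word Sig Q -> J = ~: P0 -> j0 \notin P0 ->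
  exists2 V : {set 'I_n}, exists v, v \in V &
    Delta = [set G : {set 'I_n} | G \proper V]%SET.
Proof.
move=> coxW hQ J_full j0P0; have [near_inj near] := facets_near_last.
have swap j : j \notin P0 ->
    exists2 p : 'I_n, [/\ p \in P0, (j < p)%N & rep (j |: (P0 :\ p))] &
    forall F, rep F -> j \in F -> F = j |: (P0 :\ p).
  move=> jP0; have /lin_setP[F [F_take repF Fj]] : j \in J by rewrite J_full inE.
  have neqP0 (A : {set 'I_n}) : j \in A -> A != P0 by apply: contraTneq => ->.
  have jF : j \in F by have /setP/(_ j) := Fj; rewrite !inE eqxx => /andP[].
  have [i [p [iP0 pP0 ip Fi F_eq]]] := facets_swap repF (neqP0 _ jF).
  have ij : i = j by apply/set1P; rewrite -Fj Fi set11.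
  rewrite {i}ij in iP0 ip Fi F_eq; exists p; first by rewrite -F_eq.
  move=> A repA jA; rewrite -F_eq.
  have take_rep (B : {set 'I_n}) : rep B -> j \in B ->
      B \in [set F in take (size P).-1 P].
    rewrite -memP {1}facets_rcons mem_rcons in_cons inE => + jB.
    by rewrite (negPf (neqP0 _ jB)).
  apply: near_inj; rewrite ?take_rep //= Fj.
  have [i iJ Ai] := near A repA (neqP0 _ jA); rewrite Ai; congr [set _]%SET.
  by apply/esym/set1P; rewrite -Ai inE jP0.
have near1 F : rep F -> (#|F :\: P0| <= 1)%N.
  move=> repF; have [->|F_neq] := eqVneq F P0; first by rewrite finset.setDv cards0.
  by have [j _ ->] := near F repF F_neq; rewrite cards1.
have [p [pP0 j0p rep_j0] uniq_j0] := swap j0 j0P0.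
(* Comparison with the fixed [j0] shows that every exchange gives up [p]. *)
have rep_swap j : j \notin P0 -> rep (j |: (P0 :\ p)).
  move=> jP0; have [q [qP0 jq rep_j] uniq_j] := swap j jP0.
  suff -> : p = q by [].
  have [jj0|j0j|/val_inj jj0] := ltngtP j j0.
  - exact: (esym (exchanged_position_unique hQ coxW last_facet near1 uniq_j
      jP0 j0P0 qP0 pP0 jj0 jq j0p rep_j rep_j0)).
  - exact: (exchanged_position_unique hQ coxW last_facet near1 uniq_j0
      j0P0 jP0 pP0 qP0 j0j j0p jq rep_j0 rep_j).
  rewrite jj0 in jq rep_j.
  have /setP/(_ q) := uniq_j0 _ rep_j (setU11 _ _); rewrite !inE eqxx qP0 andbT.
  have -> : (q == j0) = false by rewrite -val_eqE gtn_eqF.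
  by case: eqVneq.
exists (p |: ~: P0); first by exists p; rewrite setU11.
apply/setP => G; rewrite inE properE; apply/subword_complexP/andP.
  move=> [F repF FG]; have GF l : l \in F -> l \notin G.
    by move=> lF; rewrite (disjointFr FG).
  have [x [xV xG] F_sub] : exists2 x, x \in p |: ~: P0 /\ x \notin G &
      forall l, l \in P0 -> l != p -> l \in F.
    have [F_eq|F_neq] := eqVneq F P0.
      by exists p; [rewrite setU11 GF // F_eq|move=> l lP0 _; rewrite F_eq].
    have [j [p' [jP0 _ _ _ F_eq]]] := facets_swap repF F_neq.
    have jF : j \in F by rewrite F_eq setU11.
    have [q _ uniq_j] := swap j jP0.
    exists j; first by rewrite GF // !inE jP0 orbT.
    move=> l lP0 lp; rewrite (uniq_j F repF jF) -(uniq_j _ (rep_swap j jP0) (setU11 _ _)).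
    by rewrite !inE lp lP0 orbT.
  split; last by apply/fintype.subsetPn; exists x.
  apply/fintype.subsetP => l lG; rewrite !inE; apply: contraLR lG.
  by rewrite negb_or negbK => /andP[lp lP0]; exact/GF/F_sub.
move=> [/fintype.subsetP GV /fintype.subsetPn[x]]; rewrite !inE => /predU1P[->|xP0] xG.
  exists P0; first exact: last_facet.
  rewrite disjoint_sym finset.disjoints_subset; apply/fintype.subsetP => l lG.
  by have := GV l lG; rewrite !inE => /predU1P[lp|//]; rewrite lp (negPf xG) in lG.
exists (x |: (P0 :\ p)); first exact: rep_swap.
rewrite disjoint_sym finset.disjoints_subset; apply/fintype.subsetP => l lG.
have lx : l != x by apply: contraNneq xG => <-.
by have := GV l lG; rewrite !inE (negPf lx) negb_and negbK.
Qed.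

End Facets.
End SubwordComplex.

Theorem corollary4p2p9 (R : realType) (k : fieldType)
  (W : groupType) (Sig : set W) (hW : coxeter_system Sig) (pi : W)
  (n : nat) (Q : n.-tuple W) (hQ : is_word Sig Q)
  (hQpi : contains Sig Q [set: 'I_n]%SET pi)
  (r : nat) (P : r.-tuple {set 'I_n})
  (hG : minimal_generators
          (stanley_reisner k (alexander_dual (subword_complex Sig Q pi)))
          [seq xmon Pi | Pi <- P])
  (hlex : sorted (@lex_gt n) [seq xmon Pi | Pi <- P])
  (hr : (r <= n - coxlen Sig pi + 1)%N)
  (hd : #|lin_set k [seq xmon Pi | Pi <- P] r.-1| = (r - 1)%N) :
  simplicial_sphere R (subword_complex Sig Q pi) <->
  r = (n - coxlen Sig pi + 1)%N.
Proof.
case: P hG hlex hd => P /= /eqP P_size hG hlex hd; subst r.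
have memP := mem_minimal_generators hG.
have P_neq0 : (0 < size P)%N.
  have /containsP[F _ repF] := hQpi.
  by move: repF; rewrite -memP; case: (P).
have J_card : #|lin_set k [seq xmon F | F <- P] (size P).-1| = (size P).-1.
  by rewrite hd subn1.
set P0 := nth finset.set0 P (size P).-1.
have repP0 : represents Sig Q P0 pi by exact: last_facet memP P_neq0.
have P0C_card : #|~: P0| = (n - coxlen Sig pi)%N.
  by rewrite cardsCs finset.setCK card_ord (represents_card repP0).
have J_sub : lin_set k [seq xmon F | F <- P] (size P).-1 \subset ~: P0.
  apply/fintype.subsetP => j jJ; rewrite inE.
  exact: lin_set_disjoint memP hlex P_neq0 _ jJ.
have complex := subword_complex_simplicial hQpi.
rewrite addn1 -P0C_card in hr *.
split=> [[_ [m sphere]]|P_card].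
  apply/eqP; rewrite eqn_leq hr /= ltnNge; apply/negP => P_small.
  (* Here $|J|=r-1<n-\ell(\pi)=|Q\setminus P_r|$, which leaves a cone vertex outside both [P0] and
     [J]. *)
  have [v vP0 vJ] : exists2 v, v \in ~: P0 &
      v \notin lin_set k [seq xmon F | F <- P] (size P).-1.
    apply/fintype.subsetPn; apply: contraTN P_small => /subset_leq_card.
    by rewrite J_card -ltnNge -ltnS prednK.
  rewrite inE in vP0; apply: (@cone_not_sphere R n _ v complex _ m sphere) => G GK.
  exact: (facets_cone memP hlex P_neq0 J_card vP0 vJ GK).
split=> //; have J_full : lin_set k [seq xmon F | F <- P] (size P).-1 = ~: P0.
  by apply/eqP; rewrite eqEcard J_sub J_card P_card /= leqnn.
have [P0C_eq0|[j0]] := set_0Vmem (~: P0).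
  (* The degenerate case where [Q] itself is reduced: the complex is $\{\emptyset\}$, its
     realization is empty, and so is the unit sphere of $\mathbb R^0$. *)
  have Delta_eq G : G \in subword_complex Sig Q pi -> G = finset.set0.
    move=> /subword_complexP[F repF]; have -> : F = [set: 'I_n]%SET.
      apply/eqP; rewrite eqEcard finset.subsetT cardsT card_ord (represents_card repF).
      by rewrite -subn_eq0 -P0C_card P0C_eq0 cards0.
    by rewrite finset.disjoints_subset finset.subsetC finset.setCT finset.subset0 => /eqP.
  have no_point x : ~ @realization R n (subword_complex Sig Q pi) x.
    move=> [_ /eqP + /Delta_eq/setP supp]; rewrite big1 => [|i _].
      by rewrite eq_sym oner_eq0.
    by have := supp i; rewrite !inE => /negbFE/eqP.
  have no_vector y : ~ @unit_sphere R 0 y.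
    by rewrite /unit_sphere /= big_ord0 => /esym/eqP; rewrite oner_eq0.
  exists 0%N, (fun=> 0%R), (fun=> 0%R); split.
  - by move=> x /no_point.
  - by move=> y /no_vector.
  - by apply/subspace_continuousP => x /no_point.
  - by apply/subspace_continuousP => y /no_vector.
rewrite inE => j0P0.
have [V [v vV ->]] := facets_simplex_boundary memP hlex P_neq0 J_card hW hQ J_full j0P0.
by eexists; exact: simplex_boundary_sphere vV.
Qed.
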